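(* The following assertions hold. (1) In every multi energy parity game $G_p$: if $\mathcal P_1$ has a winning strategy (for some initial credit), then $\mathcal P_1$ has a pure finite-memory winning strategy (for some initial credit). (2) There is a polynomial $P$ such that for every multi energy parity game, and for every multi mean-payoff game with a rational threshold vector $v\in\mathbb Q^k$: if $\mathcal P_1$ has a finite-memory winning strategy, then $\mathcal P_1$ has a (pure) winning strategy whose memory is at most exponential, i.e. which is encoded by a Moore machine with at most $2^{P(n)}$ memory states, where $n$ is the size of the game (including the encoding of $v$ in the mean-payoff case). (3) There exists a family $(G(K))_{K\ge 1}$ of multi energy games (without parity), with weights in $\{-1,0,1\}$ in every dimension, in which all winning strategies require at least exponential memory: $G(K)$ has $k=2K$ dimensions and a size polynomial in $K$, $\mathcal P_1$ has a winning strategy in $G(K)$, and there is a constant $a>0$ such that for every $K$ and every initial credit $v_0\in\mathbb N^{k}$, every finite-memory strategy of $\mathcal P_1$ that is winning in $G(K)$ for $v_0$ has at least $2^{aK}$ memory states.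
   Context: A multi-weighted two-player game structure is $G=(S_1,S_2,s_{init},E,k,w)$, where $S_1,S_2$ are finite disjoint sets (states of player 1, $\mathcal P_1$, and player 2, $\mathcal P_2$), $S=S_1\cup S_2$, $s_{init}\in S$, $E\subseteq S\times S$ is such that every state has at least one successor, $k\in\mathbb N$ is the dimension and $w:E\to\mathbb Z^k$. $G_p$ denotes $G$ together with a priority function $p:S\to\mathbb N$. A play is an infinite path $\pi=s_0s_1s_2\dots$ in $(S,E)$ with $s_0=s_{init}$; $\pi(n)=s_0\dots s_n$. The energy level of a finite path $\rho=s_0\dots s_n$ is $\mathsf{EL}(\rho)=\sum_{i=0}^{n-1}w(s_i,s_{i+1})$; the mean-payoff of a play is $\mathsf{MP}(\pi)=\liminf_{n\to\infty}\frac1n\mathsf{EL}(\pi(n))$ (componentwise); $\mathsf{Par}(\pi)$ is the minimum priority among states visited infinitely often. Vectors are compared componentwise. Strategies of $\mathcal P_i$ map finite prefixes of plays ending in $S_i$ to a successor of the last state (pure), or to a distribution over successors (randomized). A pure strategy has finite memory if it is encoded by a Moore machine $(M,m_0,\alpha_u,\alpha_n)$, $M$ finite, $m_0\in M$, $\alpha_u:M\times S\to M$ (memory is updated to $\alpha_u(m,s)$ when leaving $s$), $\alpha_n:M\times S_i\to S$ (next state chosen in $s$ with memory $m$); its memory size is $|M|$. A play is consistent with a strategy if every choice of the player along it is in the support of the strategy. Objectives: $\mathsf{PosEnergy}(v_0)=\{\pi:\forall n\ge0,\ v_0+\mathsf{EL}(\pi(n))\in\mathbb N^k\}$ for $v_0\in\mathbb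 N^k$; $\mathsf{MeanPayoff}(v)=\{\pi:\mathsf{MP}(\pi)\ge v\}$; $\mathsf{Parity}=\{\pi:\mathsf{Par}(\pi)\text{ is even}\}$. In a multi energy parity game, a strategy of $\mathcal P_1$ is winning for initial credit $v_0$ if all consistent plays lie in $\mathsf{PosEnergy}(v_0)\cap\mathsf{Parity}$; it is winning if it is so for some $v_0\in\mathbb N^k$ (the initial credit is not fixed in advance). A multi energy game has no parity condition (equivalently $p\equiv0$). In a multi mean-payoff game with threshold $v$, a strategy of $\mathcal P_1$ is winning if all consistent plays lie in $\mathsf{MeanPayoff}(v)$. The size of a game is the size of its explicit encoding, with weight vectors listed for every edge and numbers in binary. *)

(* Defs.v *)
From HB Require Import structures.
From mathcomp Require Import all_boot all_order all_algebra.
From mathcomp Require Import boolp reals ereal topology normedtype sequences exp.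

Set Implicit Arguments.
Unset Strict Implicit.
Unset Printing Implicit Defensive.
Import Order.TTheory GRing.Theory Num.Theory.
Local Open Scope ring_scope.

(* The states of player 2 are those outside [states1]. The weight function is
   total on pairs of states, but its values outside [edge] are irrelevant:
   plays and sizes only look at edges. *)
Record game := Game {
  state : finType;
  states1 : {set state};
  init : state;
  edge : rel state;
  edge_total : forall s, exists t, edge s t;
  dimension : nat;
  weight : state -> state -> 'rV[int]_dimension
}.

Section Plays.
Variable G : game.
Implicit Types (h : seq (state G)) (pi : nat -> state G).

Definition is_play pi : Prop :=
  pi 0%N = init G /\ forall n, edge (pi n) (pi n.+1).

(* Finite prefixes of plays; every finite path from the initial state is one,
   since every state has a successor. *)
Definition is_prefix h : bool :=
  if h is s :: t then (s == init G) && path (@edge G) s t else false.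

Definition play_prefix pi n : seq (state G) := mkseq pi n.+1.

(* The energy level of [play_prefix pi n]. *)
Definition energy_level pi n : 'rV[int]_(dimension G) :=
  \sum_(i < n) weight (pi i) (pi i.+1).

Definition pos_energy (v0 : 'rV[nat]_(dimension G)) pi : Prop :=
  forall n j, 0 <= (v0 0 j)%:Z + energy_level pi n 0 j.

Definition mean_payoff (R : realType) pi (j : 'I_(dimension G)) : \bar R :=
  limn_einf (fun n => ((energy_level pi n 0 j)%:~R / n%:R)%:E).

Definition mean_payoff_ge (R : realType) (v : 'rV[rat]_(dimension G)) pi : Prop :=
  forall j, ((ratr (v 0 j))%:E <= mean_payoff R pi j)%E.

Definition visited_infinitely_often pi (s : state G) : Prop :=
  forall n, exists2 m, (n <= m)%N & pi m = s.

(* The neutral element [\max_s p s] never affects the value, because some state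
   is visited infinitely often and all priorities are below that maximum. *)
Definition min_priority (p : state G -> nat) pi : nat :=
  \big[minn/(\max_s p s)%N]_(s | `[< visited_infinitely_often pi s >]) p s.

Definition parity (p : state G -> nat) pi : Prop := ~~ odd (min_priority p pi).

End Plays.

(* Strategies of player 1. Histories are represented as arbitrary sequences of
   states; values outside prefixes of plays ending in [states1] are junk and are
   not constrained. *)
Record pure_strategy (G : game) := PureStrategy {
  choice_of :> seq (state G) -> state G;
  choice_edge : forall h s, is_prefix (rcons h s) -> s \in states1 G ->
    edge s (choice_of (rcons h s))
}.

Record randomized_strategy (R : realType) (G : game) := RandomizedStrategy {
  distr_of :> seq (state G) -> state G -> R;
  distr_ge0 : forall h s, is_prefix (rcons h s) -> s \in states1 G ->
    forall t, 0 <= distr_of (rcons h s) t;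
  distr_sum1 : forall h s, is_prefix (rcons h s) -> s \in states1 G ->
    \sum_t distr_of (rcons h s) t = 1;
  distr_edge : forall h s, is_prefix (rcons h s) -> s \in states1 G ->
    forall t, distr_of (rcons h s) t != 0 -> edge s t
}.

Inductive strategy (R : realType) (G : game) :=
  | Pure of pure_strategy G
  | Randomized of randomized_strategy R G.

Definition in_support (R : realType) (G : game) (sigma : strategy R G)
    (h : seq (state G)) (t : state G) : Prop :=
  match sigma with
  | Pure f => t = f h
  | Randomized d => 0 < d h t
  end.

Definition consistent (R : realType) (G : game) (sigma : strategy R G)
    (pi : nat -> state G) : Prop :=
  forall n, pi n \in states1 G -> in_support sigma (play_prefix pi n) (pi n.+1).

Definition winning (R : realType) (G : game) (sigma : strategy R G)
    (objective : (nat -> state G) -> Prop) : Prop :=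
  forall pi, is_play pi -> consistent sigma pi -> objective pi.

Definition energy_winning_for (R : realType) (G : game)
    (v0 : 'rV[nat]_(dimension G)) (sigma : strategy R G) : Prop :=
  winning sigma (pos_energy v0).

Definition energy_winning (R : realType) (G : game) (sigma : strategy R G) :
    Prop :=
  exists v0, energy_winning_for v0 sigma.

Definition energy_parity_winning (R : realType) (G : game)
    (p : state G -> nat) (sigma : strategy R G) : Prop :=
  exists v0, winning sigma (fun pi => pos_energy v0 pi /\ parity p pi).

Definition mean_payoff_winning (R : realType) (G : game)
    (v : 'rV[rat]_(dimension G)) (sigma : strategy R G) : Prop :=
  winning sigma (mean_payoff_ge R v).

Record moore_machine (G : game) := MooreMachine {
  memory : finType;
  mem_init : memory;
  mem_update : memory -> state G -> memory;
  mem_next : memory -> state G -> state G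
}.

(* In the current state [s] after the history [h], the memory has been updated
   with the states of [h] but not yet with [s]. The function [mem_next] is only
   used on states of player 1. *)
Definition encodes (G : game) (M : moore_machine G) (f : pure_strategy G) :
    Prop :=
  forall h s, is_prefix (rcons h s) -> s \in states1 G ->
    f (rcons h s) = mem_next (foldl (@mem_update G M) (mem_init M) h) s.

Definition finite_memory (G : game) (f : pure_strategy G) : Prop :=
  exists M : moore_machine G, encodes M f.

Definition memory_at_most (G : game) (N : nat) (f : pure_strategy G) : Prop :=
  exists2 M : moore_machine G, encodes M f & (#|memory M| <= N)%N.

(* Sizes of the explicit encodings. [nat_size n] is the number of binary digits
   of [n], with one digit for 0, and integers carry a sign bit. *)
Definition nat_size (n : nat) : nat := (trunc_log 2 n).+1.

Definition int_size (z : int) : nat := (nat_size `|z|%N).+1.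

Definition rat_size (q : rat) : nat :=
  (int_size (numq q) + int_size (denq q))%N.

(* The dimension and the initial state, then for every state its name and its
   owner, and for every edge the names of its ends and its weight vector. *)
Definition game_size (G : game) : nat :=
  (nat_size (dimension G) + nat_size #|state G|
   + \sum_(s : state G) (nat_size #|state G|).+1
   + \sum_(e : state G * state G | edge e.1 e.2)
       (2 * nat_size #|state G|
        + \sum_(j < dimension G) int_size (weight e.1 e.2 ord0 j)))%N.

Definition parity_game_size (G : game) (p : state G -> nat) : nat :=
  (game_size G + \sum_(s : state G) nat_size (p s))%N.

Definition threshold_game_size (G : game) (v : 'rV[rat]_(dimension G)) : nat :=
  (game_size G + \sum_(j < dimension G) rat_size (v ord0 j))%N.

(* Main.v *)
Require Import Defs.
From mathcomp Require Import all_boot all_order all_fingroup all_algebra zify ring lra.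
From mathcomp Require Import boolp reals ereal topology normedtype sequences exp.

Set Implicit Arguments.
Unset Strict Implicit.
Unset Printing Implicit Defensive.
Import Order.TTheory GRing.Theory Num.Theory.
Local Open Scope ring_scope.

(** Upper bounds: let player 2 fix a positional strategy. The play against a
    winning strategy then yields a cycle that player 1 can repeat forever, with
    nonnegative effect and even minimal priority (by Dickson's lemma for energy
    parity games, by periodicity for finite memory in mean-payoff games). Cutting
    simple cycles out of it and solving the resulting linear system by Cramer's rule
    gives such a cycle of exponential length, hence an invariant on energy vectors
    with exponential entries. Invariants for two games that differ only in the
    choices of player 2 at one state can be shuffled, their bounds adding up; doing
    this over all edges of player 2 gives an exponentially bounded invariant for the
    whole game, and the energy vectors serve as memory. Parity becomes an energy
    condition by means of a counter for each odd priority, which visits decrease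
    and smaller priorities release.

    Lower bound: player 2 chooses [K] bits that player 1 has to copy afterwards. If
    two words lead to the same memory state, player 2 can make the energy of some
    dimension arbitrarily low by choosing between them. *)

(** * Small solutions of linear systems *)

(** While one of two shuffled invariants is active, the other waits at the state where player 2
    chooses, so it must own a vector there. Lassos are therefore required from every state of a set
    [S0], the states reachable under the given winning strategy, and not only from the initial
    state. Each split of the edges of player 2 doubles the bound, hence a factor [2 ^ edges]; it is
    harmless because the size of a game counts its edges.

    Shortening a cycle must not change the set of states that it visits, since parity is expressed
    through states that free counters. A cycle is therefore cut out only where no state gets lost,
    and a skeleton of quadratic length remains.

    The objective matters only for finding lassos: once the threshold is cleared of denominators and
    subtracted, mean-payoff games also ask for a cycle with nonnegative integer effect. The lower
    bound on the energy that results is uniform over all plays and times, so it serves as initial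
    credit in the first case and vanishes in the average in the second. *)

Lemma det_norm_le n (A : 'M[int]_n) (D : nat) :
  (forall i j, `|A i j| <= D%:Z) -> `|\det A| <= (n`! * D ^ n)%N%:Z.
Proof.
move=> AD; rewrite /determinant; apply: le_trans (ler_norm_sum _ _ _) _.
have -> : ((n`! * D ^ n)%N%:Z) = \sum_(s : 'S_n) (D ^ n)%N%:Z.
  by rewrite sumr_const card_Sn -[RHS]mulr_natl natz PoszM.
apply: ler_sum => s _; rewrite normrM normrX normrN1 expr1n mul1r normr_prod.
have -> : ((D ^ n)%N%:Z) = \prod_(i < n) D%:Z.
  by rewrite prodr_const card_ord -!natz natrX.
by apply: ler_prod => i _; rewrite normr_ge0 AD.
Qed.

Definition intmx (m n : nat) (A : 'M[int]_(m, n)) : 'M[rat]_(m, n) :=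
  map_mx intr A.

(** Independent rows allow a choice of columns that form an invertible square minor [M]. Then [y] is
    [b * adj M / det M] on these columns, so [|det M|] is a common denominator, and expansion along
    the entries of [b] gives the numerators the bound of a determinant. *)
Lemma cramer_bound r d (A : 'M[int]_(r, d)) (b : 'rV[int]_d) (y : 'rV[rat]_r)
    (D : nat) :
  (0 < D)%N -> row_free (intmx A) ->
  (forall i j, `|A i j| <= D%:Z) -> (forall j, `|b 0 j| <= D%:Z) ->
  y *m intmx A = intmx b ->
  exists2 N : nat, (0 < N <= d`! * D ^ d)%N &
    forall i, exists2 z : int, y 0 i * N%:R = z%:~R & `|z| <= (d`! * D ^ d)%N%:Z.
Proof.
move=> D0 Afree AD bD yA.
have rd : (r <= d)%N by move/eqP: Afree => <-; exact: rank_leq_col.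
have le_rd : ((r`! * D ^ r)%N <= (d`! * D ^ d)%N)%N.
  apply: leq_mul; last by rewrite leq_pexp2l.
  by apply: leq_fact.
have Ffull : row_full (intmx A)^T by rewrite /row_full mxrank_tr.
pose g := fullrankfun Ffull.
pose M := colsub g A.
have Mu : intmx M \in unitmx.
  have := fullrowsub_unit Ffull.
  rewrite -unitmx_tr.
  by congr (_ \in unitmx); apply/matrixP => i j; rewrite !mxE.
have yM : y *m intmx M = intmx (colsub g b).
  have -> : intmx (colsub g b) = colsub g (intmx b) by apply/matrixP=> i j; rewrite !mxE.
  by rewrite -yA; apply/matrixP => i j; rewrite !mxE; apply: eq_bigr => k _; rewrite !mxE.
have detM : \det (intmx M) = (\det M)%:~R by rewrite det_map_mx.
have detM0 : \det M != 0 by move: Mu; rewrite unitmxE detM unitfE intr_eq0.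
exists `|\det M|%N.
  rewrite absz_gt0 detM0 /=; apply: leq_trans le_rd.
  by rewrite -lez_nat abszE; apply: det_norm_le => i j; rewrite mxE.
move=> i.
have yE : y 0 i * (\det M)%:~R = ((colsub g b *m \adj M) 0 i)%:~R.
  have : y *m intmx M *m \adj (intmx M) = intmx (colsub g b) *m \adj (intmx M) by rewrite yM.
  rewrite -mulmxA mul_mx_adj mul_mx_scalar detM.
  have -> : \adj (intmx M) = intmx (\adj M) by rewrite /intmx map_mx_adj.
  rewrite /intmx -map_mxM => /matrixP/(_ 0 i); rewrite !mxE => <-.
  by rewrite mulrC.
exists ((colsub g b *m \adj M) 0 i * Num.sg (\det M)).
  by rewrite intrM -yE -mulrA natr_absz -intrM
             mulrC [in RHS]mulrC [_ * Num.sg _]mulrC -normrEsg.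
rewrite normrM normr_sg detM0.
rewrite mulr1; apply: (@le_trans _ _ (r`! * D ^ r)%N%:Z); last by rewrite lez_nat.
have r0 : (0 < r)%N by apply: leq_ltn_trans (ltn_ord i).
have -> : ((r`! * D ^ r)%N%:Z) = \sum_(j < r) (D * ((r.-1)`! * D ^ r.-1))%N%:Z.
  rewrite sumr_const card_ord -mulr_natl natz -PoszM; congr Posz.
  by rewrite -{1 2}(prednK r0) factS expnS prednK //; lia.
rewrite mxE; apply: le_trans (ler_norm_sum _ _ _) _.
apply: ler_sum => j _; rewrite normrM PoszM ler_pM ?normr_ge0 //.
  by rewrite !mxE bD.
rewrite mxE /cofactor normrM normrX normrN1 expr1n mul1r.
by apply: det_norm_le => k l; rewrite !mxE AD.
Qed.

(* Carathéodory: a minimal support carries linearly independent vectors, so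
   that Cramer's rule applies. *)
Lemma small_solution (I : finType) d (a : I -> 'rV[int]_d) (b : 'rV[int]_d)
    (D : nat) (T : {set I}) (x : I -> rat) :
  (0 < D)%N -> (forall i j, `|a i 0 j| <= D%:Z) ->
  (forall j, `|b 0 j| <= D%:Z) -> {in T, forall i, 0 < x i} ->
  \sum_(i in T) x i *: intmx (a i) = intmx b ->
  exists N : nat, exists n : I -> nat,
    [/\ (0 < N <= d`! * D ^ d)%N, (\sum_i n i <= d * (d`! * D ^ d))%N &
        forall j, \sum_i (n i)%:Z * a i 0 j = N%:Z * b 0 j].
Proof.
move=> D0 aD bD; have [m] := ubnP #|T|; elim: m T x => // m IHm T x ltTm x0 xb.
pose A := \matrix_(k < #|T|) a (enum_val k).
pose y := \row_(k < #|T|) x (enum_val k).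
have rowA (z : 'rV[rat]_#|T|) :
    z *m intmx A = \sum_k z 0 k *: intmx (a (enum_val k)).
  rewrite mulmx_sum_row; apply: eq_bigr => k _; congr (_ *: _).
  by apply/rowP => j; rewrite !mxE.
have yA : y *m intmx A = intmx b.
  by rewrite rowA -xb [RHS]big_enum_val; apply: eq_bigr => k _; rewrite mxE.
have [Afree | Adep] := boolP (row_free (intmx A)).
  have AD i j : `|A i j| <= D%:Z by rewrite mxE.
  have [N NB /fin_all_exists2 [z zE zB]] := cramer_bound D0 Afree AD bD yA.
  (* [z] is indexed by positions in [T]; the sum carries it over to [I], with value 0 outside
     [T]. *)
  exists N, (fun i => \sum_(k < #|T| | enum_val k == i) `|z k|)%N.
  have sumE (V : nmodType) (f : 'I_#|T| -> V) :
      \sum_i \sum_(k < #|T| | enum_val k == i) f k = \sum_k f k.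
    rewrite (exchange_big_dep predT) //=; apply: eq_bigr => k _.
    by rewrite (big_pred1 (enum_val k)) // => i; rewrite eq_sym.
  have leTd : (#|T| <= d)%N by move/eqP: Afree => <-; exact: rank_leq_col.
  split=> //.
    have -> := sumE nat (fun k => `|z k|%N).
    apply: (@leq_trans (\sum_(k < #|T|) (d`! * D ^ d))%N).
      by apply: leq_sum => k _; rewrite -lez_nat abszE.
    by rewrite sum_nat_const card_ord leq_mul2r leTd orbT.
  have zabs k : `|z k|%N%:Z = z k.
    rewrite abszE ger0_norm // -(ler0z rat) -zE mxE mulr_ge0 ?ler0n //.
    by rewrite ltW // x0 // enum_valP.
  move=> j; apply: (@intr_inj rat).
  transitivity ((\sum_i \sum_(k < #|T| | enum_val k == i) z k * a (enum_val k) 0 j)%:~R : rat).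
    congr (_%:~R); apply: eq_bigr => i _; rewrite -natz natr_sum mulr_suml.
    by apply: eq_bigr => k /eqP <-; rewrite natz zabs.
  rewrite sumE rmorph_sum /= intrM.
  have /rowP/(_ j) := yA; rewrite rowA summxE [RHS]mxE => <-.
  rewrite mulr_sumr; apply: eq_bigr => k _.
  by rewrite intrM -zE /intmx !mxE -pmulrn; ring.
have [z zA /matrix0Pn[i0 [k1 zk]]] : exists2 z : 'rV[rat]_#|T|, z *m intmx A = 0 & z != 0.
  rewrite -kermx_eq0 in Adep; have /rowV0Pn[z zK z0] := Adep.
  by exists z => //; apply/sub_kermxP.
rewrite ord1 in zk => {i0}.
wlog zk0 : z zA zk / 0 < z 0 k1.
  move=> wl; case: (ltrP 0 (z 0 k1)) => [|le0]; first exact: wl.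
  apply: (wl (- z)); rewrite ?mulNmx ?zA ?oppr0 // mxE ?oppr_eq0 //.
  by rewrite oppr_gt0 lt_neqAle zk.
have Tk1 : enum_val k1 \in T by exact: enum_valP.
pose zt i := z 0 (enum_rank_in Tk1 i).
have zt0 : \sum_(i in T) zt i *: intmx (a i) = 0.
  transitivity (z *m intmx A); rewrite // rowA big_enum_val.
  apply: eq_bigr => k _.
  by rewrite /zt enum_valK_in.
(* Ratio test: subtracting the least ratio times the kernel vector kills the coefficient of [k0] and
   keeps the others nonnegative, so the support shrinks. *)
case: (@arg_minP _ _ _ k1 (fun k => 0 < z 0 k)
  (fun k => x (enum_val k) / z 0 k) zk0) => k0 zk00 k0min.
pose th := x (enum_val k0) / z 0 k0.
have th0 : 0 <= th by rewrite divr_ge0 ?ltW // x0 // enum_valP.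
pose x' i := x i - th * zt i.
have x'0 : {in T, forall i, 0 <= x' i}.
  move=> i Ti; rewrite subr_ge0; have [zi|zi] := ltrP 0 (zt i).
    by rewrite -ler_pdivlMr //; have := k0min _ zi; rewrite enum_rankK_in.
  by apply: le_trans (ltW (x0 _ Ti)); rewrite mulr_ge0_le0.
apply: (IHm [set i in T | 0 < x' i] x').
- rewrite -ltnS; apply: leq_trans ltTm; rewrite ltnS; apply: proper_card.
  apply/properP; split; first by apply/subsetP => i; rewrite inE => /andP[].
  exists (enum_val k0); first exact: enum_valP.
  by rewrite inE /x' /th /zt enum_valK_in divfK ?subrr ?ltxx ?andbF // gt_eqF.
- by move=> i; rewrite inE => /andP[].
- transitivity (\sum_(i in T) x' i *: intmx (a i)); last first.
    under eq_bigr do rewrite scalerBl -scalerA.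
    by rewrite sumrB -scaler_sumr zt0 scaler0 subr0.
  rewrite [RHS](bigID (fun i => 0 < x' i)) /= [X in _ = _ + X]big1 ?addr0.
    by apply: eq_bigl => i; rewrite inE.
  move=> i /andP[Ti]; rewrite -leNgt => x'le; have := x'0 i Ti => x'ge.
  by rewrite (@le_anti _ _ (x' i) 0) ?scale0r // x'le.
Qed.

(** One slack column per dimension, the opposite of a unit vector, turns the inequalities into
    equations that the coefficients 1 solve. The bounds of [small_solution] do not involve the
    number of columns, hence not [m]. *)
Lemma small_combination (J : finType) (m : nat) (u : J -> int)
    (v : 'I_m -> J -> int) (D : nat) :
  (0 < D)%N -> (forall j, `|u j| <= D%:Z) -> (forall i j, `|v i j| <= D%:Z) ->
  (forall j, 0 <= u j + \sum_i v i j) ->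
  exists N : nat, exists n : 'I_m -> nat,
    [/\ (0 < N <= #|J|`! * D ^ #|J|)%N,
        (\sum_i n i <= #|J| * (#|J|`! * D ^ #|J|))%N &
        forall j, 0 <= N%:Z * u j + \sum_i (n i)%:Z * v i j].
Proof.
move=> D0 uD vD uv0.
pose a (i : 'I_m + J) : 'rV[int]_#|J| :=
  match i with
  | inl i => \row_k v i (enum_val k)
  | inr j => \row_k - (k == enum_rank j)%:Z
  end.
pose b : 'rV[int]_#|J| := \row_k - u (enum_val k).
pose x (i : 'I_m + J) : int :=
  match i with inl i => 1 | inr j => u j + \sum_i v i j end.
have sumE (F : 'I_m + J -> rat) :
    \sum_i F i = \sum_i F (inl i) + \sum_j F (inr j).
  by rewrite big_sumType.
have [||||N [n [NB nB nE]]] :=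
    @small_solution _ _ a b D [set i | 0 < x i] (fun i => (x i)%:~R) D0.
- case=> [i|j] k; rewrite !mxE //.
  by rewrite normrN; case: (_ == _); rewrite /= ?normr0 ?normr1 //; lia.
- by move=> k; rewrite mxE normrN.
- by move=> i; rewrite inE ltr0z.
- apply/rowP => k; rewrite summxE.
  transitivity (\sum_i (x i)%:~R * (a i 0 k)%:~R : rat).
    rewrite [RHS](bigID (fun i => 0 < x i)) /= [X in _ = _ + X]big1 ?addr0.
      by apply: eq_big => i; rewrite ?inE // /intmx !mxE.
    case=> [i //|j /= le0]; have := uv0 j => ge0.
    suff -> : u j + \sum_i v i j = 0 by rewrite mul0r.
    by apply/eqP; rewrite eq_le ge0 leNgt le0.
  rewrite sumE /= (bigD1 (enum_val k)) //= [X in _ + (_ + X)]big1 => [|j].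
    rewrite !mxE enum_valK eqxx addr0; apply/eqP; rewrite -subr_eq0; apply/eqP.
    rewrite -[RHS](_ : 0%:~R = 0) //; under eq_bigr do rewrite mul1r mxE.
    rewrite -rmorph_sum /= -intrM -!intrD -intrB; congr (_%:~R); ring.
  rewrite eq_sym -(inj_eq enum_rank_inj) enum_valK mxE => /negPf ->.
  by rewrite oppr0 mulr0.
exists N, (fun i => n (inl i)); split=> //.
  by apply: leq_trans nB; rewrite big_sumType /= leq_addr.
move=> j; have := nE (enum_rank j); rewrite big_sumType /= mxE enum_rankK.
have ->: \sum_i (n (inr i))%:Z * (a (inr i) 0 (enum_rank j)) = - (n (inr j))%:Z.
  rewrite (bigD1 j) //= big1 ?addr0 => [|i].
    by rewrite mxE eqxx mulrN1.
  by rewrite mxE eq_sym (inj_eq enum_rank_inj) => /negPf ->; rewrite oppr0 mulr0.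
under eq_bigr do rewrite mxE enum_rankK.
rewrite mulrN; set s := \sum_i _; set c := N%:Z * _; lia.
Qed.

(** * Closed walks of exponential length *)

Section Walks.
Variables (S J : finType) (e : rel S) (w : S -> S -> J -> int) (W : nat).
Hypothesis w_bound : forall s t j, e s t -> `|w s t j| <= W%:Z.
Local Notation N := #|S|.

Fixpoint effect (s : S) (c : seq S) (j : J) : int :=
  if c is t :: c' then w s t j + effect t c' j else 0.

Lemma effect_cat s c d j :
  effect s (c ++ d) j = effect s c j + effect (last s c) d j.
Proof. by elim: c s => [|t c IHc] s /=; rewrite ?add0r // IHc addrA. Qed.

Lemma effect_bound s c j : path e s c -> `|effect s c j| <= (W * size c)%N%:Z.
Proof.
elim: c s => [|t c IHc] s /=; first by rewrite normr0.
case/andP=> est /IHc IH; rewrite mulnS PoszD.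
by apply: le_trans (ler_normD _ _) _; apply: lerD => //; exact: w_bound.
Qed.

Definition closed_walk (s : S) (c : seq S) : bool :=
  [&& c != [::], path e s c & last s c == s].

(* Some block of [N.+1] consecutive positions contains no first occurrence; the
   cycle is taken inside this block. *)
Lemma remove_cycle s (c : seq S) : (N.+1 * N.+1 <= size c)%N ->
  exists c1 d c2, [/\ c = c1 ++ d ++ c2, last (last s c1) d = last s c1,
    (0 < size d <= N)%N & {subset c <= c1 ++ c2}].
Proof.
move=> szc.
have [b bP] : exists b : 'I_N.+1, forall a, (index a c %/ N.+1 != b)%N.
  pose f (a : S) : 'I_N.+1 := inord (index a c %/ N.+1).
  have /existsP[b bP] : [exists b, b \notin codom f].
    rewrite -negb_forall; apply/negP => /forallP allb.
    have : (#|'I_N.+1| <= #|codom f|)%N.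
      by apply/subset_leq_card/subsetP => b _; exact: allb.
    by rewrite card_ord leqNgt ltnS (leq_trans (card_size _)) // size_codom.
  exists b => a; apply: contraNneq bP => ab; apply/codomP; exists a.
  by rewrite /f ab inord_val.
pose B := take N.+1 (drop (b * N.+1) c).
have szB : size B = N.+1.
  rewrite size_take size_drop; have := ltn_ord b => ltb.
  have : (b * N.+1 + N.+1 <= size c)%N by apply: leq_trans szc;
    rewrite addnC -mulSn leq_mul2r ltb orbT.
  by case: ltnP; lia.
have : ~~ uniq B by apply/negP => /card_uniqP h; have := max_card (mem B); rewrite h szB ltnn.
case/(uniqPn s) => i [k [ltik + eik]]; rewrite szB => ltkB.
have nthB l : (l < N.+1)%N -> nth s B l = nth s c (b * N.+1 + l).
  by move=> ltl; rewrite nth_take // nth_drop.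
have ltP : (b * N.+1 + k < size c)%N.
  have : (b * N.+1 + N.+1 <= size c)%N by apply: leq_trans szc;
    rewrite addnC -mulSn leq_mul2r ltn_ord orbT.
  lia.
pose P := (b * N.+1 + i)%N; pose Q := (b * N.+1 + k)%N.
exists (take P.+1 c), (take (Q - P) (drop P.+1 c)), (drop Q.+1 c); split.
- rewrite (_ : drop Q.+1 c = drop (Q - P) (drop P.+1 c)) ?cat_take_drop //.
  by rewrite drop_drop; congr drop; lia.
- have lastP : last s (take P.+1 c) = nth s c P.
    rewrite (last_nth s) size_take; case: ifP => h; last by lia.
    by rewrite /= nth_take.
  rewrite lastP (last_nth s) size_take size_drop.
  have -> : (if (Q - P < size c - P.+1)%N then (Q - P)%N
             else (size c - P.+1)%N) = (Q - P).-1.+1 by case: ifP; lia.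
  rewrite /= nth_take; last by lia.
  rewrite nth_drop; have -> : (P.+1 + (Q - P).-1)%N = Q by lia.
  by rewrite -nthB -?nthB ?eik //; lia.
- by rewrite size_take size_drop; case: ifP; lia.
move=> a ac; rewrite mem_cat.
have := bP a; set I := index a c => Ib.
have ltI : (I < size c)%N by rewrite index_mem.
have nI : nth s c I = a by rewrite nth_index.
case: (ltnP I P.+1) => [ltIP|leP].
  by rewrite -nI -(@nth_take P.+1) // mem_nth // size_take; case: ifP.
apply/orP; right.
have ltQ : (Q < I)%N.
  rewrite ltnNge; apply: contra Ib => leIQ.
  rewrite eqn_leq -ltnS ltn_divLR // leq_divRL //; apply/andP; split; lia.
rewrite -nI -[I](subnKC ltQ) -nth_drop mem_nth // size_drop.
by apply: ltn_sub2r => //; exact: leq_ltn_trans ltQ ltI.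
Qed.

(** All states of the cycle lie in [u], so inserting it any number of times leaves the set of
    visited states, and hence of freed dimensions, unchanged. *)
Definition cycle_in (u : seq S) (ad : S * seq S) : bool :=
  [&& ad.1 \in u, path e ad.1 ad.2, last ad.1 ad.2 == ad.1, (size ad.2 <= N)%N
    & all (mem u) ad.2].

Lemma cycle_in_eq u u' : u =i u' -> cycle_in u =1 cycle_in u'.
Proof.
move=> uu' ad; rewrite /cycle_in uu'; do 4!congr (_ && _).
by apply: eq_all => a; rewrite /= uu'.
Qed.

(** Cycles are removed as long as [remove_cycle] applies. No removal loses a state, so every removed
    cycle still lies within the states of the final [u] and can be put back there. *)
Lemma skeleton s c : closed_walk s c -> exists u ds,
  [/\ closed_walk s u, u =i c, (size u <= N.+1 * N.+1)%N, all (cycle_in u) ds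
    & forall j, effect s c j = effect s u j + \sum_(ad <- ds) effect ad.1 ad.2 j].
Proof.
have [m] := ubnP (size c); elim: m c => // m IHm c ltcm cc.
have [szc|szc] := leqP (size c) (N.+1 * N.+1).
  by exists c, [::]; split=> // j; rewrite big_nil addr0.
have [c1 [d [c2 [cE dcyc dsz sub]]]] := remove_cycle s (ltnW szc).
have c12 : c1 ++ c2 =i c.
  move=> a; apply/idP/idP; last exact: sub.
  by rewrite cE !mem_cat => /orP[]->; rewrite ?orbT.
case/and3P: cc => c0; rewrite {1 2}cE !cat_path !last_cat dcyc.
case/and3P => pc1 pd pc2 lc.
have [|| u [ds [cu uE usz dsP eff]]] := IHm (c1 ++ c2).
- by move: ltcm; rewrite cE !size_cat; lia.
- rewrite /closed_walk cat_path pc1 pc2 last_cat lc !andbT.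
  by apply/eqP => c0'; move: c0; case: (c) c12 => // a c' /(_ a); rewrite c0' !inE eqxx.
exists u, ((last s c1, d) :: ds); split=> //.
- by move=> a; rewrite uE c12.
- rewrite /= dsP andbT /cycle_in /= pd dcyc eqxx.
  have /andP[d0 ->] := dsz; rewrite !uE /=; apply/andP; split.
    rewrite c12 -dcyc cE !mem_cat; case: (d) d0 => //= a d' _.
    by rewrite mem_last orbT.
  by apply/allP => a ad; rewrite /= uE c12 cE !mem_cat ad orbT.
- move=> j; rewrite big_cons /= addrCA -eff {1}cE !effect_cat dcyc; ring.
Qed.

Lemma insert_cycle s u ad : closed_walk s u -> cycle_in u ad -> exists u',
  [/\ closed_walk s u', u' =i u, size u' = (size u + size ad.2)%N &
    forall j, effect s u' j = effect s u j + effect ad.1 ad.2 j].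
Proof.
case: ad => a d /and3P[u0 pu lu] /and5P[/= + pd /eqP ld _ /allP du].
move=> au; case/splitPr: au pu lu du {u0} => p1 p2 pu lu du.
exists (p1 ++ a :: d ++ p2).
move: pu lu; rewrite cat_path last_cat /= => /and3P[p1s p1a p2s] lp2.
split.
- rewrite /closed_walk; apply/and3P; split; first by case: (p1).
    by rewrite cat_path /= cat_path p1s p1a pd ld.
  by rewrite last_cat /= last_cat ld.
- move=> x; rewrite !mem_cat !inE !mem_cat; case xd: (x \in d) => //=.
  by have := du x xd; rewrite /= !mem_cat inE; case/or3P => ->; rewrite ?orbT.
- by rewrite !size_cat /= size_cat; lia.
- by move=> j; rewrite !effect_cat /= effect_cat ld; ring.
Qed.

Lemma insert_cycles s u m (ad : 'I_m -> S * seq S) (n : 'I_m -> nat) :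
  closed_walk s u -> (forall i, cycle_in u (ad i)) -> exists u',
  [/\ closed_walk s u', u' =i u, (size u' <= size u + (\sum_i n i) * N)%N &
    forall j, effect s u' j
      = effect s u j + \sum_i (n i)%:Z * effect (ad i).1 (ad i).2 j].
Proof.
have repeat a : cycle_in u a -> forall k v, closed_walk s v -> v =i u -> exists v',
    [/\ closed_walk s v', v' =i u, (size v' <= size v + k * N)%N &
      forall j, effect s v' j = effect s v j + k%:Z * effect a.1 a.2 j].
  move=> ua; elim=> [|k IHk] v cv vu.
    by exists v; split=> // [|j]; rewrite ?mul0r ?addr0 // addn0.
  have [v1 [cv1 v1u sz1 eff1]] := IHk v cv vu.
  have ua1 : cycle_in v1 a by rewrite (cycle_in_eq v1u).
  have [v2 [cv2 v2u sz2 eff2]] := insert_cycle cv1 ua1.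
  exists v2; split=> // [x||j]; first by rewrite v2u v1u.
    rewrite sz2 mulSn; case/and5P: ua => _ _ _ le _; lia.
  by rewrite eff2 eff1 intS; ring.
move=> cu adu.
suff /(_ (index_enum _)) H : forall r : seq 'I_m, exists u',
  [/\ closed_walk s u', u' =i u, (size u' <= size u + (\sum_(i <- r) n i) * N)%N &
    forall j, effect s u' j
      = effect s u j + \sum_(i <- r) (n i)%:Z * effect (ad i).1 (ad i).2 j].
  exact: H.
elim=> [|i r [v [cv vu szv effv]]].
  by exists u; split=> // [|j]; rewrite big_nil ?addr0 // addn0.
have [v' [cv' v'u szv' effv']] := repeat _ (adu i) (n i) v cv vu.
exists v'; split=> // [|j]; rewrite big_cons; first by rewrite mulnDl; lia.
by rewrite effv' effv; ring.
Qed.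

Lemma repeat_walk s u k : closed_walk s u -> (0 < k)%N -> exists u',
  [/\ closed_walk s u', u' =i u, size u' = (k * size u)%N &
    forall j, effect s u' j = k%:Z * effect s u j].
Proof.
move=> cu; case: k => // k _; elim: k => [|k [v [cv vu szv effv]]].
  by exists u; split=> // [|j]; rewrite ?mul1r ?mul1n.
case/and3P: cu => u0 pu /eqP lu; case/and3P: cv => v0 pv lv.
exists (u ++ v); split.
- apply/and3P; split; first by case: (u) u0.
    by rewrite cat_path pu lu.
  by rewrite last_cat lu.
- by move=> x; rewrite mem_cat vu orbb.
- by rewrite size_cat szv; lia.
- by move=> j; rewrite effect_cat lu effv (intS k.+1); ring.
Qed.

Variable free : S -> J -> bool.

Definition good_walk (s : S) (c : seq S) : Prop :=
  forall j, has (free^~ j) c || (0 <= effect s c j).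

Definition coef_bound : nat := (#|J|`! * (W * (N.+1 * N.+1)) ^ #|J|)%N.
Definition walk_bound : nat :=
  (coef_bound * (N.+1 * N.+1) + #|J| * coef_bound * N)%N.

(** The effect of [c] is that of its skeleton plus that of an unbounded number of short cycles.
    [small_combination] replaces this sum by [k > 0] copies of the skeleton and few cycles. Freed
    dimensions stay freed, so they are set to 0 in the system. *)
Lemma short_good_walk s c : (0 < W)%N -> closed_walk s c -> good_walk s c ->
  exists c', [/\ closed_walk s c', good_walk s c' & (size c' <= walk_bound)%N].
Proof.
move=> W0 cc gc; have [u [ds [cu uc szu dsP eff]]] := skeleton cc.
pose fr j := has (free^~ j) c.
pose ad (i : 'I_(size ds)) := nth (s, [::]) ds i.
have adP i : cycle_in u (ad i) by apply: (allP dsP); rewrite mem_nth.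
have [/and3P[_ pu _]] := cu.
have ltD (x : nat) : (x <= N.+1 * N.+1)%N -> (W * x)%N%:Z <= (W * (N.+1 * N.+1))%N%:Z.
  by move=> h; rewrite lez_nat leq_mul2l h orbT.
have [||||k [n [kB nB kn]]] := @small_combination J (size ds)
  (fun j => if fr j then 0 else effect s u j)
  (fun i j => if fr j then 0 else effect (ad i).1 (ad i).2 j)
  (W * (N.+1 * N.+1))%N.
- by rewrite muln_gt0 W0.
- move=> j; case: ifP => _; first by rewrite normr0.
  by apply: le_trans (effect_bound j pu) _; exact: ltD.
- move=> i j; case: ifP => _; first by rewrite normr0.
  have /and5P[_ pd _ szd _] := adP i.
  by apply: le_trans (effect_bound j pd) _; apply: ltD; lia.
- move=> j; case: ifP => frj; first by rewrite big1.
  have := gc j; rewrite -/(fr j) frj /= eff => h; apply: le_trans h _.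
  by rewrite (big_nth (s, [::])) big_mkord.
have /andP[k0 kC] := kB.
have [u1 [cu1 u1u sz1 eff1]] := repeat_walk cu k0.
have adP1 i : cycle_in u1 (ad i) by rewrite (cycle_in_eq u1u).
have [u2 [cu2 u2u sz2 eff2]] := insert_cycles n cu1 adP1.
exists u2; split=> //.
  move=> j; have -> : has (free^~ j) u2 = fr j.
    by apply: eq_has_r => x; rewrite u2u u1u uc.
  have := kn j; case: (fr j) => //= h; rewrite eff2 eff1.
  by under eq_bigr do rewrite -[effect _ _ _]/(effect _ _ _).
apply: leq_trans sz2 _; rewrite sz1; apply: leq_add; first exact: leq_mul.
by rewrite leq_mul2r nB orbT.
Qed.
End Walks.

Lemma effect_sum (S J : finType) (w : S -> S -> J -> int) s c j :
  effect w s c j =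
  \sum_(i < size c) w (nth s (s :: c) i) (nth s (s :: c) i.+1) j.
Proof.
elim: c s => [|t c IHc] s /=; first by rewrite big_ord0.
rewrite big_ord_recl /= IHc; congr (_ + _); apply: eq_bigr => i _ /=.
by congr (w _ _ j); apply: set_nth_default; rewrite //= ltnS ltnW.
Qed.

Lemma periodic_sum (f : nat -> int) (N L a : nat) :
  (forall n, (N <= n)%N -> f (n + L)%N = f n) -> (N <= a)%N ->
  \sum_(a <= m < a + L) f m = \sum_(N <= m < N + L) f m.
Proof.
move=> fL /subnKC <-; elim: (a - N)%N => [|k IHk]; first by rewrite addn0.
rewrite -IHk addnS addSn; case: L fL {IHk} => [|L] fL.
  by rewrite addn0 !big_geq.
rewrite big_nat_recr /=; last by lia.
have lt_aL : (N + k < N + k + L.+1)%N by lia.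
by rewrite fL ?leq_addr // [RHS](big_ltn lt_aL) [RHS]addrC.
Qed.

(** * Invariants with bounded counters *)

Section Lasso.
Variables (S J : finType) (w : S -> S -> J -> int) (free : S -> J -> bool).

(** The inequality allows credit to be thrown away, which makes capping possible; when a state that
    frees [j] is left, the counter of [j] may take any value. *)
Definition step (q : S) (x : J -> nat) (q' : S) (x' : J -> nat) : Prop :=
  forall j, free q j || ((x' j)%:Z <= (x j)%:Z + w q q' j).

Variables (e : rel S) (W : nat).
Hypothesis w_bound : forall s t j, e s t -> `|w s t j| <= W%:Z.

Section Run.
Variables (pi : nat -> S) (N L : nat).
Hypothesis pi_edge : forall n, e (pi n) (pi n.+1).
Hypothesis pi_period : forall n, (N <= n)%N -> pi (n + L)%N = pi n.
Hypothesis L_gt0 : (0 < L)%N.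
Hypothesis pi_good : forall j,
  (exists2 m, (N <= m < N + L)%N & free (pi m) j) \/
  0 <= \sum_(N <= m < N + L) w (pi m) (pi m.+1) j.

(** A segment longer than [N + L] ends with a full period, which has a nonnegative sum as it does
    not free [j], and can be cut off. What remains has at most [N + L] steps, each losing at most
    [W]. *)
Lemma bounded_drop i n j : (i <= n)%N ->
  (forall m, (i <= m < n)%N -> ~~ free (pi m) j) ->
  - (W * (N + L))%N%:Z <= \sum_(i <= m < n) w (pi m) (pi m.+1) j.
Proof.
have [k] := ubnP n; elim: k n => // k IHk n ltnk le_in nofree.
have [short|long] := leqP (n - i) (N + L).
  apply: (@le_trans _ _ (\sum_(i <= m < n) - W%:Z)).
    rewrite sumrN lerN2 sumr_const_nat -mulr_natr natz -PoszM lez_nat.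
    by rewrite leq_mul2l short orbT.
  by apply: ler_sum => m _;
     rewrite lerNl (le_trans _ (w_bound j (pi_edge m))) // -normrN ler_norm.
rewrite (@big_cat_nat _ _ _ (n - L)%N) /=; try lia.
rewrite -[leLHS]addr0; apply: lerD.
  by apply: IHk => [||m mi]; [lia | lia | apply: nofree; lia].
have nE : n = (n - L + L)%N by lia.
have le_Nn : (N <= n - L)%N by lia.
have per (g : nat -> int) : (forall m, (N <= m)%N -> g (m + L)%N = g m) ->
    \sum_(n - L <= m < n) g m = \sum_(N <= m < N + L) g m.
  by move=> gL; rewrite {2}nE; exact: periodic_sum.
rewrite per; last by move=> m le_Nm; rewrite -addSn !pi_period // ltnW.
case: (pi_good j) => // -[m mN frm].
(* The last period of the segment frees nothing at [j]; by periodicity neither does the loop,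
   against [frm]. *)
have : \sum_(N <= m < N + L) (free (pi m) j)%:Z = 0.
  rewrite -per => [|m' le_Nm]; last by rewrite pi_period.
  rewrite big_nat big1 // => m' m'n; rewrite (negPf (nofree _ _)) //; lia.
move/eqP; rewrite psumr_eq0 // => /allP/(_ m).
by rewrite mem_index_iota frm => /(_ mN).
Qed.

Definition capped (B : nat) (j : J) : nat -> int :=
  fix x n := if n is n'.+1 then
    if free (pi n') j then B%:Z else Num.min B%:Z (x n' + w (pi n') (pi n) j)
  else B%:Z.

(** [i] is the last moment at which the counter was reset or cut to [B]; since then it has just
    summed weights. By [bounded_drop] it stays nonnegative when [B] is [W * (N + L)]. *)
Lemma cappedE B j n : exists2 i, (i <= n)%N &
  (forall m, (i <= m < n)%N -> ~~ free (pi m) j) /\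
  capped B j n = B%:Z + \sum_(i <= m < n) w (pi m) (pi m.+1) j.
Proof.
have now k : exists2 i, (i <= k)%N &
  (forall m, (i <= m < k)%N -> ~~ free (pi m) j) /\
  B%:Z = B%:Z + \sum_(i <= m < k) w (pi m) (pi m.+1) j.
  by exists k => //; rewrite big_geq // addr0; split=> // m; lia.
elim: n => [|n [i le_in [nofree IHn]]]; first exact: now.
rewrite /=; case: ifP => [_ | frn]; first exact: now.
rewrite minEle; case: ifP => _; first exact: now.
exists i; first exact: leqW.
split; last by rewrite IHn big_nat_recr //= addrA.
by move=> m /andP[le_im];
  rewrite ltnS leq_eqVlt => /predU1P[->|ltmn]; rewrite ?frn // nofree ?le_im.
Qed.

Lemma run_bounded : exists x : nat -> J -> nat,
  forall n, (forall j, (x n j <= W * (N + L))%N)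
    /\ step (pi n) (x n) (pi n.+1) (x n.+1).
Proof.
set B := (W * (N + L))%N.
have x0 n j : 0 <= capped B j n.
  have [i le_in [nofree ->]] := cappedE B j n.
  by rewrite -lerBlDl sub0r bounded_drop.
have xE n j : (`|capped B j n|%N)%:Z = capped B j n by rewrite gez0_abs.
exists (fun n j => `|capped B j n|%N) => n; split=> j.
  rewrite -lez_nat xE; case: n => [|n] //=.
  by case: ifP => // _; rewrite ge_min lexx.
by rewrite !xE /=; case: (free _ _) => //=; rewrite ge_min lexx orbT.
Qed.
End Run.

Definition has_lasso (q : S) : Prop := exists p c,
  [/\ path e q p, closed_walk e (last q p) c
    & good_walk w free (last q p) c].

Definition lasso_bound : nat := (W * (#|S| + walk_bound S J W))%N.

(** The stem can be replaced by a simple path and the cycle by one of length at most [walk_bound];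
    the run follows the stem and then repeats the cycle. *)
Lemma lasso_run q : (0 < W)%N -> has_lasso q ->
  exists (pi : nat -> S) (x : nat -> J -> nat), pi 0%N = q /\
    forall n, [/\ e (pi n) (pi n.+1), forall j, (x n j <= lasso_bound)%N
      & step (pi n) (x n) (pi n.+1) (x n.+1)].
Proof.
move=> W0 [p0 [c0 [path_p0 cc0 gc0]]].
have [c [cc gc szc]] := short_good_walk w_bound W0 cc0 gc0.
case/shortenP: path_p0 cc gc => p path_p p_uniq _.
set t := last q p => /and3P[c_neq0 path_c /eqP last_c] gc.
have leN : (size p <= #|S|)%N.
  by apply: ltnW; have := max_card (mem (q :: p)); rewrite (card_uniqP p_uniq).
set N := size p in leN *; pose L := size c.
have L0 : (0 < L)%N by rewrite /L; case: (c) c_neq0.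
pose pi n := if (n <= N)%N then nth q (q :: p) n else nth t c ((n - N.+1) %% L).
have piS m : pi (N + m).+1 = nth t c (m %% L).
  by rewrite /pi ltnNge leq_addr /= subSS addKn.
have piE m : pi (N + m)%N = nth t (t :: c) (m %% L).
  (* At multiples of [L] the run is back at [t], which is both the head of [t :: c] and the last
     element of [c]. *)
  case: m => [|m]; first by rewrite addn0 mod0n /pi leqnn /= /t (last_nth q).
  rewrite addnS piS modnS; case: ifP => //= dvdL.
  rewrite -[RHS]last_c (last_nth t) -/L.
  have : (m %% L).+1 = L.
    have dvdL' : (L %| (m %% L).+1)%N.
      by rewrite -(dvdn_addr _ (dvdn_mull (m %/ L) (dvdnn L))) addnS -divn_eq.
    by apply/eqP; rewrite eqn_leq ltn_pmod // dvdn_leq.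
  by case: (L) => // L' [->].
have pi_e n : e (pi n) (pi n.+1).
  have [leNn|ltnN] := leqP N n.
    rewrite -(subnKC leNn) piS piE; have := ltn_pmod (n - N) L0.
    by move: (_ %% _)%N => m ltm; apply: (pathP t path_c).
  by rewrite /pi ltnW // ltnN; apply: (pathP q path_p).
have [|||x xP] := @run_bounded pi N L pi_e.
- by move=> n leNn; rewrite -(subnKC leNn) -addnA !piE modnDr.
- exact: L0.
- move=> j; case/orP: (gc j) => [/hasP[a ac fra] | ge0]; [left | right].
    (* Index [i] of [c] is visited at time [N + i + 1]; the remainder moves the end of the cycle
       back to time [N], inside the window. *)
    exists (N + (index a c).+1 %% L)%N.
      by rewrite leq_addr ltn_add2l ltn_pmod.
    rewrite piE modn_mod -piE addnS piS modn_small ?nth_index //.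
    by rewrite index_mem.
  rewrite effect_sum in ge0; apply: le_trans ge0 _; rewrite le_eqVlt; apply/orP; left.
  rewrite -{1}[N]add0n big_addn addKn big_mkord; apply/eqP; apply: eq_bigr => i _.
  by rewrite addnC piS piE modn_small.
exists pi, x; split; first by rewrite /pi.
move=> n; have [bx stx] := xP n; split=> //; last first.
  by move=> j; apply: leq_trans (bx j) _; rewrite leq_mul2l leq_add ?orbT.
Qed.
End Lasso.

(** * Shuffling invariants over the choices of player 2 *)

Section Invariants.
Variables (S J : finType) (w : S -> S -> J -> int) (free : S -> J -> bool).
Variables (S1 : {set S}).
Local Notation step := (step w free).

Definition invariant (e : rel S) (B : nat) (C : S -> (J -> nat) -> Prop) : Prop :=
  forall q x, C q x ->
  [/\ forall j, (x j <= B)%N,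
      q \in S1 -> exists q' x', [/\ e q q', C q' x' & step q x q' x'] &
      q \notin S1 -> forall q', e q q' -> exists2 x', C q' x' & step q x q' x'].

Lemma step_add q x q' x' y z : (forall j, z j = (x j + y j)%N) ->
  step q x q' x' -> step q z q' (fun j => x' j + y j)%N.
Proof.
move=> zE st j; case/orP: (st j) => [->//|le]; apply/orP; right.
by rewrite zE !PoszD addrAC lerD2r.
Qed.

Definition shuffle (Ca Cb : S -> (J -> nat) -> Prop) s q (z : J -> nat) : Prop :=
  exists x y, [/\ forall j, z j = (x j + y j)%N, Ca q x & Cb s y].

(** The active component answers every move of its own relation, the waiting vector being added
    unchanged. If player 2 leaves [s] along an edge of the waiting component, both components are at
    [s] and exchange roles. *)
Lemma shuffle_active (e ea eb : rel S) Ba Bb Ca Cb s q z :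
  s \notin S1 ->
  (forall t, e s t -> ea s t \/ eb s t) ->
  (forall q t, q != s -> e q t = ea q t) ->
  invariant ea Ba Ca -> invariant eb Bb Cb -> shuffle Ca Cb s q z ->
  let C q z := shuffle Ca Cb s q z \/ shuffle Cb Ca s q z in
  [/\ forall j, (z j <= Ba + Bb)%N,
      q \in S1 -> exists q' z', [/\ e q q', C q' z' & step q z q' z'] &
      q \notin S1 -> forall q', e q q' -> exists2 z', C q' z' & step q z q' z'].
Proof.
move=> sS1 es eE inva invb [x [y [zE qx sy]]] C.
have [bx x1 x2] := inva _ _ qx; have [bY y1 y2] := invb _ _ sy.
have active q' x' : Ca q' x' -> step q x q' x' ->
    C q' (fun j => x' j + y j)%N /\ step q z q' (fun j => x' j + y j)%N.
  move=> qx' st; split; first by left; exists x', y.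
  exact: step_add st.
split=> [j | qS1 | qS1 q' eqq'].
- by rewrite zE leq_add.
- have [q' [x' [eqq' qx' st]]] := x1 qS1.
  exists q', (fun j => x' j + y j)%N; have [] := active q' x' qx' st; split=> //.
  by rewrite eE //; apply: contraNneq sS1 => <-.
have by_a : ea q q' -> exists2 z', C q' z' & step q z q' z'.
  move=> /(x2 qS1)[x' qx' st]; have [] := active q' x' qx' st.
  by exists (fun j => x' j + y j)%N.
have [qs|qs] := eqVneq q s; last by apply: by_a; rewrite -eE.
subst q; case: (es _ eqq') => [/by_a //|/(y2 qS1)[y' qy' st]].
exists (fun j => y' j + x j)%N; first by right; exists y', x.
by apply: step_add st => j; rewrite zE addnC.
Qed.

(* Both invariants are played in turn: while one of them is active, the other
   one waits at [s], until the opponent leaves [s] along one of its edges. *)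
Lemma invariant_shuffle (e e1 e2 : rel S) B1 B2 C1 C2 s :
  s \notin S1 ->
  (forall t, e s t -> e1 s t \/ e2 s t) ->
  (forall q t, q != s -> e q t = e1 q t /\ e q t = e2 q t) ->
  invariant e1 B1 C1 -> invariant e2 B2 C2 ->
  invariant e (B1 + B2) (fun q z => shuffle C1 C2 s q z \/ shuffle C2 C1 s q z).
Proof.
move=> sS1 es eE inv1 inv2 q z [] sh.
  have eE' q' t : q' != s -> e q' t = e1 q' t by case/(eE q' t).
  exact (shuffle_active sS1 es eE' inv1 inv2 sh).
have es' t : e s t -> e2 s t \/ e1 s t by case/es; [right | left].
have eE' q' t : q' != s -> e q' t = e2 q' t by case/(eE q' t).
have [b z1 z2] := shuffle_active sS1 es' eE' inv2 inv1 sh.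
split=> [j | qS1 | qS1 q' eqq']; first by rewrite addnC.
  have [q' [z' [eqq' Cz' st]]] := z1 qS1; exists q', z'; split=> //.
  by case: Cz'; [right | left].
by have [z' Cz' st] := z2 qS1 q' eqq'; exists z' => //; case: Cz'; [right | left].
Qed.

Lemma invariant_le e B B' C : (B <= B')%N -> invariant e B C -> invariant e B' C.
Proof.
move=> leB inv q x /inv [bx x1 x2]; split=> // j.
exact: leq_trans leB.
Qed.

Variables (S0 : {set S}) (W : nat).
Hypothesis W_gt0 : (0 < W)%N.

Definition fix_opponent (e : rel S) (tau : S -> S) : rel S :=
  fun a b => e a b && ((a \in S1) || (b == tau a)).

Local Notation has_lasso := (has_lasso w free).
Local Notation lasso_bound := (lasso_bound S J W).

(** When player 2 has no choice, the pairs of state and counters met along runs form an invariant,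
    since the only edge of player 2 is the one that the run takes. *)
Lemma lasso_invariant (e : rel S) :
  (forall s t j, e s t -> `|w s t j| <= W%:Z) ->
  (forall q t t', q \notin S1 -> e q t -> e q t' -> t = t') ->
  {in S0, forall q, has_lasso e q} ->
  exists2 C, invariant e lasso_bound C & {in S0, forall q, exists x, C q x}.
Proof.
move=> w_bound det lasso.
exists (fun q y => exists (pi : nat -> S) (x : nat -> J -> nat) n,
  [/\ q = pi n, y = x n & forall n, [/\ e (pi n) (pi n.+1), forall j, (x n j <= lasso_bound)%N
      & step (pi n) (x n) (pi n.+1) (x n.+1)]]).
  move=> _ _ [pi [x [n [-> -> run]]]]; have [e_n x_n st_n] := run n.
  have next : exists pi' x' n', [/\ pi n.+1 = pi' n', x n.+1 = x' n' &
      forall n, [/\ e (pi' n) (pi' n.+1), forall j, (x' n j <= lasso_bound)%N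
      & step (pi' n) (x' n) (pi' n.+1) (x' n.+1)]] by exists pi, x, n.+1.
  split=> // [_ | qS1 q' eqq']; first by exists (pi n.+1), (x n.+1).
  by exists (x n.+1); rewrite -(det _ _ _ qS1 e_n eqq').
move=> q /lasso /(lasso_run w_bound W_gt0) [pi [x [pi0 run]]].
by exists (x 0%N), pi, x, 0%N; rewrite pi0.
Qed.

Lemma has_lasso_sub (e e' : rel S) q : subrel e e' -> has_lasso e q -> has_lasso e' q.
Proof.
move=> sub [p [c [pp /and3P[c0 pc lc] gc]]]; exists p, c; split=> //.
  exact: sub_path pp.
by apply/and3P; split=> //; exact: sub_path pc.
Qed.

(** Induction measure: the edges in excess of one per state of player 2, fewer in both halves of a
    split. *)
Definition branching (e : rel S) : nat :=
  \sum_(s in S0 :\: S1) #|[pred t | e s t]|.-1.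

Let invariant_without_choice (e : rel S) :
  (forall s t j, e s t -> `|w s t j| <= W%:Z) ->
  (forall s t, e s t -> s \in S0) ->
  (forall s, s \in S0 :\: S1 -> exists t, e s t) ->
  (forall tau, {in S0 :\: S1, forall s, e s (tau s)} ->
     {in S0, forall q, has_lasso (fix_opponent e tau) q}) ->
  {in S0 :\: S1, forall s, #|[pred t | e s t]| <= 1}%N ->
  exists2 C, invariant e lasso_bound C & {in S0, forall q, exists x, C q x}.
Proof.
move=> w_bound eS0 e_tot lasso single; apply: lasso_invariant => //.
  move=> q t t' qS1 eqt eqt'.
  have qS : q \in S0 :\: S1 by rewrite inE qS1 (eS0 _ _ eqt).
  by apply: (card_le1_eqP (single q qS)); rewrite inE.
pose tau s := odflt s [pick t | e s t].
have tauE : {in S0 :\: S1, forall s, e s (tau s)}.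
  move=> s sS; rewrite /tau; case: pickP => [t //|no].
  by have [t] := e_tot s sS; rewrite no.
move=> q qS; apply: has_lasso_sub (lasso tau tauE q qS).
by move=> a b /andP[].
Qed.

(** Induction on [branching]: at a state with two successors, the edge to [t1] is separated from the
    other edges. A positional choice of player 2 in one part is also one in [e], so both parts
    inherit the lassos; shuffling then adds two equal bounds. *)
Theorem bounded_invariant (e : rel S) :
  (forall s t j, e s t -> `|w s t j| <= W%:Z) ->
  (forall s t, e s t -> s \in S0) ->
  (forall s, s \in S0 :\: S1 -> exists t, e s t) ->
  (forall tau, {in S0 :\: S1, forall s, e s (tau s)} ->
     {in S0, forall q, has_lasso (fix_opponent e tau) q}) ->
  exists2 C, invariant e (2 ^ branching e * lasso_bound) C
    & {in S0, forall q, exists x, C q x}.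
Proof.
suff H n : (branching e <= n)%N ->
  (forall s t j, e s t -> `|w s t j| <= W%:Z) ->
  (forall s t, e s t -> s \in S0) ->
  (forall s, s \in S0 :\: S1 -> exists t, e s t) ->
  (forall tau, {in S0 :\: S1, forall s, e s (tau s)} ->
     {in S0, forall q, has_lasso (fix_opponent e tau) q}) ->
  exists2 C, invariant e (2 ^ n * lasso_bound) C
    & {in S0, forall q, exists x, C q x} by exact: H.
elim: n e => [|n IHn] e le_n w_bound eS0 e_tot lasso;
  have [/forall_inP single | ] := boolP [forall s in S0 :\: S1, (#|[pred t | e s t]| <= 1)%N].
- by rewrite mul1n; apply: invariant_without_choice.
- case/forall_inPn => s sS; rewrite -ltnNge => lt1.
  by move: le_n; rewrite /branching (bigD1 s) //=; move: (#|_|) lt1 => k; lia.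
- have [C inv Cq] := invariant_without_choice w_bound eS0 e_tot lasso single.
  exists C => //; apply: invariant_le inv; rewrite leq_pmull // expn_gt0 //.
case/forall_inPn => s sS; rewrite -ltnNge => /card_gt1P[t1 [t2 [est1 est2 t12]]].
rewrite !inE in est1 est2.
have [sS1 sS0] : s \notin S1 /\ s \in S0 by case/setDP: sS.
pose part (P : pred S) : rel S := fun a b => e a b && ((a != s) || P b).
have part_sub P : subrel (part P) e by move=> a b /andP[].
have partE P q t : q != s -> part P q t = e q t by rewrite /part => ->; rewrite andbT.
have partS P t : part P s t = e s t && P t by rewrite /part eqxx.
have IHpart (P : pred S) t t' : e s t -> P t -> e s t' -> ~~ P t' ->
    exists2 C, invariant (part P) (2 ^ n * lasso_bound) C
    & {in S0, forall q, exists x, C q x}.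
  move=> est Pt est' Pt'; apply: IHn.
  - rewrite -ltnS; apply: leq_trans le_n; rewrite /branching (bigD1 s) //=.
    rewrite [X in (_ < X)%N](bigD1 s) //= -addSn; apply: leq_add.
      have lt_card : (#|[pred t | part P s t]| < #|[pred t | e s t]|)%N.
        apply: proper_card; apply/properP; split.
          by apply/subsetP => u; rewrite !inE partS => /andP[].
        by exists t'; rewrite !inE ?partS // (negPf Pt') andbF.
      have gt0_card : (0 < #|[pred t | part P s t]|)%N.
        by apply/card_gt0P; exists t; rewrite !inE partS est.
      by rewrite -ltnS !prednK // (leq_ltn_trans _ lt_card).
    apply: leq_sum => q /andP[_ qs]; apply: eq_leq; congr _.-1.
    by apply: eq_card => u; rewrite !inE partE.
  - by move=> a b j /part_sub; exact: w_bound.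
  - by move=> a b /part_sub; exact: eS0.
  - move=> a aS; have [->|as_] := eqVneq a s; first by exists t; rewrite partS est.
    by have [b eab] := e_tot a aS; exists b; rewrite partE.
  - move=> tau tauE q qS0.
    apply: has_lasso_sub (lasso tau _ q qS0) => [a b|a aS]; last exact: part_sub (tauE a aS).
    rewrite /fix_opponent => /andP[eab ab]; rewrite ab andbT.
    have [as_|as_] := eqVneq a s; last by rewrite partE.
    by move: ab; rewrite as_ (negPf sS1) /= => /eqP ->; exact: tauE.
have t12' : ~~ pred1 t1 t2 by rewrite /= eq_sym.
have [C1 inv1 C1q] := IHpart (pred1 t1) t1 t2 est1 (eqxx _) est2 t12'.
have t11 : ~~ predC1 t1 t1 by rewrite /= eqxx.
have [C2 inv2 C2q] := IHpart (predC1 t1) t2 t1 est2 t12' est1 t11.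
exists (fun q z => shuffle C1 C2 s q z \/ shuffle C2 C1 s q z).
  rewrite expnS mul2n -addnn mulnDl; apply: invariant_shuffle inv1 inv2 => //.
    by move=> t est; rewrite !partS est /=; case: eqVneq; [left | right].
  by move=> q t qs; rewrite !partE.
(* The second component begins by waiting at [s], where [C2q] provides its vector. *)
move=> q qS0; have [x qx] := C1q q qS0; have [y sy] := C2q s sS0.
by exists (fun j => x j + y j)%N; left; exists x, y.
Qed.
End Invariants.

Lemma step_energy (S J : finType) (w : S -> S -> J -> int) free pi
    (x : nat -> J -> nat) j :
  (forall n, ~~ free (pi n) j) ->
  (forall n, step w free (pi n) (x n) (pi n.+1) (x n.+1)) ->
  forall n, (x n j)%:Z <= (x 0%N j)%:Z + \sum_(m < n) w (pi m) (pi m.+1) j.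
Proof.
move=> nofree run; elim=> [|n IHn]; first by rewrite big_ord0 addr0.
rewrite big_ord_recr /= addrA; have := run n j; rewrite (negPf (nofree n)) /=.
by move/le_trans; apply; rewrite lerD2r.
Qed.

(** * From invariants to strategies *)

Section StrategyOfInvariant.
Variables (R : realType) (G : game) (J : finType).
Variables (w : state G -> state G -> J -> int) (free : state G -> J -> bool).
Variables (B : nat) (C : state G -> (J -> nat) -> Prop).
Hypothesis inv : invariant w free (states1 G) (@edge G) B C.

Local Notation config := {ffun J -> 'I_B.+1}.

Definition counters (k : config) : J -> nat := fun j => k j.

Definition good_move (q : state G) (k : config) (q' : state G) (k' : config) : bool :=
  `[< C q' (counters k') /\ step w free q (counters k) q' (counters k') >].

Lemma good_moveP q k q' k' : reflect
  (C q' (counters k') /\ step w free q (counters k) q' (counters k'))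
  (good_move q k q' k').
Proof. exact: asboolP. Qed.

Lemma countersP q x : C q x -> exists k : config, counters k = x.
Proof.
move=> /inv [bx _ _]; exists [ffun j => inord (x j)].
by apply: funext => j; rewrite /counters ffunE inordK // ltnS.
Qed.

Variable k0 : config.
Hypothesis k0P : C (init G) (counters k0).

(** Memory is updated only when a state is left. It therefore holds the previous state with its
    counters, or [None] at the start, and the counters of the current state are computed on
    arrival. *)
Definition config_at (m : option (state G * config)) (s : state G) : config :=
  if m is Some (q, k) then odflt k0 [pick k' | good_move q k s k'] else k0.

Definition update m s := Some (s, config_at m s).

Definition next_state m (s : state G) : state G :=
  let k := config_at m s in
  odflt (xchoose (edge_total s))
    [pick q' | edge s q' && [exists k', good_move s k q' k']].

Lemma next_state_edge m s : edge s (next_state m s).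
Proof.
rewrite /next_state; case: pickP => [q' /andP[]//|_] /=; exact: xchooseP.
Qed.

Definition invariant_choice (h : seq (state G)) : state G :=
  if rev h is s :: r then next_state (foldl update None (rev r)) s else init G.

Lemma invariant_choice_rcons h s :
  invariant_choice (rcons h s) = next_state (foldl update None h) s.
Proof. by rewrite /invariant_choice rev_rcons revK. Qed.

Lemma invariant_choice_edge h s : is_prefix (rcons h s) -> s \in states1 G ->
  edge s (invariant_choice (rcons h s)).
Proof. by rewrite invariant_choice_rcons => _ _; exact: next_state_edge. Qed.

Definition invariant_strategy := PureStrategy invariant_choice_edge.

Lemma invariant_strategy_memory :
  memory_at_most (#|state G| * B.+1 ^ #|J|).+1 invariant_strategy.
Proof.
exists (MooreMachine None update next_state).
  by move=> h s _ _; rewrite /= invariant_choice_rcons.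
by rewrite /= card_option card_prod card_ffun card_ord.
Qed.

Lemma invariant_strategy_run pi : is_play pi ->
  consistent (Pure R invariant_strategy) pi ->
  exists x : nat -> J -> nat, forall n, (forall j, (x n j <= B)%N) /\
    step w free (pi n) (x n) (pi n.+1) (x n.+1).
Proof.
move=> [pi0 pi_e] cons.
pose m n := foldl update None (mkseq pi n).
pose k n := config_at (m n) (pi n).
have mS n : m n.+1 = Some (pi n, k n).
  by rewrite /m mkseqS foldl_rcons.
have good n : C (pi n) (counters (k n)) -> good_move (pi n) (k n) (pi n.+1) (k n.+1).
  move=> Cn; suff [k' gk'] : exists k', good_move (pi n) (k n) (pi n.+1) k'.
    by rewrite {2}/k mS /=; case: pickP => [//|/(_ k')]; rewrite gk'.
  have [_ inv1 inv2] := inv Cn.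
  have [S1n|S1n] := boolP (pi n \in states1 G); last first.
    have [x' Cx' st] := inv2 S1n _ (pi_e n).
    by have [k' kx'] := countersP Cx'; exists k'; apply/good_moveP; rewrite kx'.
  have := cons n S1n; rewrite /= /play_prefix mkseqS.
  rewrite invariant_choice_rcons -/(m n) /next_state -/(k n).
  case: pickP => [q' /andP[_ /existsP[k' gk']] /= -> | no _]; first by exists k'.
  have [q' [x' [eq' Cx' st]]] := inv1 S1n.
  have [k' kx'] := countersP Cx'.
  have := no q'; rewrite eq' /= => /existsP[]; exists k'.
  by apply/good_moveP; rewrite kx'.
have Cn n : C (pi n) (counters (k n)).
  elim: n => [|n IHn]; first by rewrite /k /m /= pi0.
  by case/good_moveP: (good n IHn).
exists (fun n => counters (k n)) => n; split.
  by have [bx _ _] := inv (Cn n).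
by case/good_moveP: (good n (Cn n)).
Qed.
End StrategyOfInvariant.

(** * The least priority visited infinitely often *)

Section MinPriority.
Variables (G : game) (p : state G -> nat) (pi : nat -> state G).

Lemma eventually_recurrent :
  exists N, forall n, (N <= n)%N -> visited_infinitely_often pi (pi n).
Proof.
have /fin_all_exists[N NP] : forall s, exists N, visited_infinitely_often pi s \/
    forall n, (N <= n)%N -> pi n <> s.
  move=> s; case: (pselect (visited_infinitely_often pi s)) => [|no].
    by exists 0%N; left.
  apply: contrapT => /forallNP noN; apply: no => N.
  apply: contrapT => noM; apply: (noN N); right => n leNn pin; apply: noM.
  by exists n.
exists (\max_s N s) => n len; case: (NP (pi n)) => // /(_ n); case=> //.
exact: leq_trans (leq_bigmax _) len.
Qed.

Lemma min_priorityP : exists s N, [/\ visited_infinitely_often pi s,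
  p s = min_priority p pi & forall n, (N <= n)%N -> (min_priority p pi <= p (pi n))%N].
Proof.
have [N NP] := eventually_recurrent.
have min_le s : visited_infinitely_often pi s -> (min_priority p pi <= p s)%N.
  move=> vis; rewrite /min_priority -big_filter.
  have le_r (r : seq (state G)) m : s \in r -> (\big[minn/m]_(t <- r) p t <= p s)%N.
    elim: r => // a r IHr; rewrite inE big_cons geq_min.
    by case/predU1P => [->|/IHr->]; rewrite ?leqnn ?orbT.
  by apply: le_r; rewrite mem_filter mem_index_enum andbT; apply/asboolP.
have [|[s vis sE]] : min_priority p pi = (\max_s p s)%N \/
    exists2 s, visited_infinitely_often pi s & p s = min_priority p pi.
- rewrite /min_priority; apply: (big_ind (fun v => v = (\max_s p s)%N \/
    exists2 s, visited_infinitely_often pi s & p s = v))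
    => [|a b [->|[s vis <-]] [->|[t vit <-]]|s /asboolP vis].
  + by left.
  + by left; rewrite minnn.
  + by right; exists t => //; rewrite (minn_idPr (leq_bigmax _)).
  + by right; exists s => //; rewrite (minn_idPl (leq_bigmax _)).
  + by right; case: (leqP (p s) (p t)) => _; [exists s | exists t].
  + by right; exists s.
(* The neutral element is the largest priority, so here the recurrent state [pi N] has that priority
   too. *)
- move=> minE; have vis := NP N (leqnn N); exists (pi N), N; split=> //.
    by apply/eqP; rewrite eqn_leq min_le // minE leq_bigmax.
  by move=> n /NP /min_le.
by exists s, N; split=> // n /NP /min_le.
Qed.
End MinPriority.

(** * Parity as an energy condition *)

Section EnergyParity.
Variables (R : realType) (G : game) (d : nat).
Variables (w : state G -> state G -> 'I_d -> int) (p : state G -> nat).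
Local Notation J := ('I_d + state G)%type.

Definition energy (pi : nat -> state G) (n : nat) (i : 'I_d) : int :=
  \sum_(m < n) w (pi m) (pi m.+1) i.

(* The counter of a state [c] of odd priority bounds the number of visits to
   priority [p c] before a smaller priority is visited, which frees it. *)
Definition counter_weight (q q' : state G) (j : J) : int :=
  match j with
  | inl i => w q q' i
  | inr c => - (odd (p c) && (p q == p c))%:Z
  end.

Definition counter_free (q : state G) (j : J) : bool :=
  if j is inr c then (p q < p c)%N else false.

Section Run.
Variables (pi : nat -> state G) (x : nat -> J -> nat).
Hypothesis run : forall n,
  step counter_weight counter_free (pi n) (x n) (pi n.+1) (x n.+1).

Lemma run_energy n i : - (x 0%N (inl i))%:Z <= energy pi n i.
Proof.
have := @step_energy _ _ _ counter_free _ _ (inl i) (fun _ => isT) run n.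
by rewrite -/(energy pi n i); lia.
Qed.

(** If the least recurring priority were odd and attained at [c], then from some time on the counter
    of [c] would never be freed, never grow, and lose 1 at each of infinitely many visits to [c]. *)
Lemma run_parity : parity p pi.
Proof.
have [c [N [vis cE ge_c]]] := min_priorityP p pi.
apply/negP => odd_c; rewrite -{}cE in ge_c odd_c.
have mono n m : (N <= n <= m)%N -> (x m (inr c) <= x n (inr c))%N.
  case/andP=> leNn /subnKC <-; elim: (m - n)%N => [|k IHk]; first by rewrite addn0.
  rewrite addnS; apply: leq_trans IHk; have /= := run (n + k) (inr c).
  rewrite ltnNge ge_c /=; last by rewrite (leq_trans leNn) ?leq_addr.
  by case: (_ && _); lia.
have drop k : exists2 n, (N <= n)%N & (x n (inr c) + k <= x N (inr c))%N.
  elim: k => [|k [n leNn IHk]]; first by exists N; rewrite ?addn0.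
  have [m le_nm pim] := vis n; have leNm := leq_trans leNn le_nm.
  exists m.+1; first exact: leqW.
  have := mono n m; rewrite leNn le_nm => /(_ isT).
  by have /= := run m (inr c); rewrite pim ltnn odd_c eqxx /=; lia.
by have [n _] := drop (x N (inr c)).+1; lia.
Qed.
End Run.

Variables (S0 : {set state G}) (W : nat).
Hypothesis W_gt0 : (0 < W)%N.
Hypothesis w_bound : forall s t i, edge s t -> `|w s t i| <= W%:Z.
Hypothesis init_S0 : init G \in S0.
Hypothesis closed_S0 : forall s t, s \in S0 :\: states1 G -> edge s t -> t \in S0.

Definition edges : nat := #|[pred a : state G * state G | edge a.1 a.2]|.

Definition inside : rel (state G) :=
  fun s t => [&& edge s t, s \in S0 & t \in S0].

Definition winning_lasso (e : rel (state G)) (q : state G) : Prop := exists h c,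
  [/\ path e q h, closed_walk e (last q h) c,
      forall i, 0 <= effect w (last q h) c i
    & exists2 a, a \in c & ~~ odd (p a) /\ {in c, forall b, (p a <= p b)%N}].

(** The counter of [b] is freed by [a] if [p a < p b]. Otherwise a visit to priority [p b] on the
    cycle would force [p b = p a], which is even, so the counter never decreases. *)
Lemma winning_has_lasso e q : winning_lasso e q ->
  has_lasso counter_weight counter_free e q.
Proof.
move=> [h [c [path_h cc eff [a ac [even_a min_a]]]]]; exists h, c; split=> //.
case=> [i|b] /=; apply/orP.
  right; apply: le_trans (eff i) _; rewrite le_eqVlt; apply/orP; left; apply/eqP.
  by elim: (c) (last q h) => //= t c' IHc s; rewrite IHc.
have [lt_ab|le_ba] := ltnP (p a) (p b); [left | right].
  by apply/hasP; exists a.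
have odd_lt t : t \in c -> odd (p b) && (p t == p b) = false.
  move=> tc; apply/negP => /andP[odd_b /eqP tb].
  have := min_a t tc; rewrite tb => le_ab.
  by move: even_a; rewrite (_ : p a = p b) ?odd_b //; lia.
have [/and3P[c0 _ /eqP lc]] := cc.
(* Counters are charged at the source of each step, so the base point of the cycle must be on the
   cycle as well. *)
have : last q h \in c.
  by rewrite -{1}lc; case: (c) c0 => //= t c' _; exact: mem_last.
suff H c' : forall s, s \in c -> {subset c' <= c} ->
    effect counter_weight s c' (inr b) = 0 by move=> sc; rewrite H.
elim: c' => //= t c' IHc s sc sub.
rewrite odd_lt // oppr0 add0r IHc //; first by apply: sub; rewrite mem_head.
by move=> u uc; apply: sub; rewrite inE uc orbT.
Qed.

Definition counter_bound : nat :=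
  (2 ^ edges * lasso_bound (state G) ('I_d + state G)%type W)%N.

Lemma branching_edges : (branching (states1 G) S0 inside <= edges)%N.
Proof.
rewrite /branching /edges -sum1_card.
rewrite -(pair_big_dep xpredT (fun s t => edge s t) (fun _ _ => 1%N)) /=.
rewrite [X in (_ <= X)%N](bigID (mem (S0 :\: states1 G))) /=.
apply: leq_trans (leq_addr _ _); apply: leq_sum => s _.
rewrite sum1_card; apply: leq_trans (leq_pred _) _.
by apply: subset_leq_card; apply/subsetP => t; rewrite !inE => /and3P[].
Qed.

(** Player 2 cannot leave [S0], so an invariant for the edges inside [S0] is one for the whole
    game. *)
Theorem energy_parity_strategy :
  (forall tau, {in S0 :\: states1 G, forall s, inside s (tau s)} ->
    {in S0, forall q, winning_lasso (fix_opponent (states1 G) inside tau) q}) ->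
  exists2 f : pure_strategy G,
    memory_at_most (#|state G| * counter_bound.+1 ^ (d + #|state G|)).+1 f &
    exists B : nat, forall pi, is_play pi -> consistent (Pure R f) pi ->
      (forall n i, - B%:Z <= energy pi n i) /\ parity p pi.
Proof.
move=> lasso.
have [C inv CS0] : exists2 C, invariant counter_weight counter_free (states1 G)
    inside counter_bound C & {in S0, forall q, exists x, C q x}.
  have [|||tau tauE q qS0|C inv CS0] := @bounded_invariant _ _
    counter_weight counter_free (states1 G) S0 W W_gt0 inside.
  - move=> s t [i|c] /and3P[est _ _]; first exact: w_bound.
    by rewrite normrN; case: (_ && _); rewrite ?normr0 ?normr1 //; lia.
  - by move=> s t /and3P[].
  - move=> s sS; have [t est] := edge_total s; exists t.
    by rewrite /inside est (closed_S0 sS est); case/setDP: sS => ->.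
  - exact: winning_has_lasso (lasso tau tauE q qS0).
  exists C => //; apply: invariant_le inv.
  by rewrite leq_mul2r leq_exp2l // branching_edges orbT.
have invG : invariant counter_weight counter_free (states1 G) (@edge G)
    counter_bound (fun q x => C q x /\ q \in S0).
  move=> q x [/inv[bx x1 x2] qS0]; split=> // [qS1 | qS1 t eqt].
    have [q' [x' [/and3P[eqq' _ q'S0] Cx' st]]] := x1 qS1.
    by exists q', x'.
  have tS0 : t \in S0 by apply: closed_S0 eqt; rewrite inE qS1.
  by have [|x' Cx' st] := x2 qS1 t; [apply/and3P | exists x'].
have [x0 Cx0] := CS0 _ init_S0.
have [k0 k0E] := countersP invG (conj Cx0 init_S0).
have Ck0 : C (init G) (counters k0) /\ init G \in S0 by rewrite k0E.
exists (invariant_strategy counter_weight counter_free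
  (fun q x => C q x /\ q \in S0) k0).
  have := invariant_strategy_memory counter_weight counter_free
    (fun q x => C q x /\ q \in S0) k0.
  by rewrite card_sum card_ord.
exists counter_bound => pi play cons.
have [x xP] := invariant_strategy_run invG Ck0 play cons.
split; last by apply: (@run_parity pi x) => n; case: (xP n).
move=> n i; apply: le_trans (run_energy (x := x) _ n i).
  by rewrite lerN2 lez_nat; case: (xP 0%N).
by move=> m; case: (xP m).
Qed.
End EnergyParity.

(** * Plays against a positional opponent *)

Section Plays.
Variables (R : realType) (G : game).

Lemma play_prefixS (pi : nat -> state G) n :
  play_prefix pi n = rcons (mkseq pi n) (pi n).
Proof. exact: mkseqS. Qed.

Lemma is_prefix_rcons (h : seq (state G)) s t :
  is_prefix (rcons h s) -> edge s t -> is_prefix (rcons (rcons h s) t).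
Proof.
case: h => [|a h] /=; first by rewrite !andbT => -> ->.
by rewrite !rcons_path last_rcons -andbA => /and3P[-> -> ->].
Qed.

Lemma play_exists (F : seq (state G) -> state G) :
  (forall h s, is_prefix (rcons h s) -> edge s (F (rcons h s))) ->
  exists2 pi, is_play pi & forall n, pi n.+1 = F (play_prefix pi n).
Proof.
move=> F_edge.
pose H n := iter n (fun h => rcons h (F h)) [:: init G].
pose pi n := last (init G) (H n).
have HE n : H n = play_prefix pi n.
  elim: n => //= n IHn.
  by rewrite play_prefixS -[mkseq pi n.+1]/(play_prefix pi n) -IHn /pi /= last_rcons.
have piS n : pi n.+1 = F (play_prefix pi n) by rewrite {1}/pi /= last_rcons HE.
exists pi => //; split=> //.
have pre n : is_prefix (play_prefix pi n).
  elim: n => [|n IHn]; first by rewrite /= eqxx.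
  rewrite play_prefixS -[mkseq pi n.+1]/(play_prefix pi n) piS.
  move: (IHn); rewrite play_prefixS => IHn'.
  by apply: is_prefix_rcons => //; exact: F_edge.
by move=> n; have := pre n; rewrite piS play_prefixS; exact: F_edge.
Qed.

Variables (f : pure_strategy G).
Local Notation consistent := (consistent (Pure R f)).

Definition against (tau : state G -> state G) (h : seq (state G)) : state G :=
  let s := last (init G) h in if s \in states1 G then f h else tau s.

Definition some_edge (s : state G) : state G := xchoose (edge_total s).

Lemma some_edgeP s : edge s (some_edge s). Proof. exact: xchooseP. Qed.

Lemma against_edge tau : {in ~: states1 G, forall s, edge s (tau s)} ->
  forall h s, is_prefix (rcons h s) -> edge s (against tau (rcons h s)).
Proof.
move=> tauE h s pre; rewrite /against last_rcons.
by case: ifPn => sS1; [exact: choice_edge | apply: tauE; rewrite inE].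
Qed.

Lemma play_extend pi n tau : is_play pi -> consistent pi ->
  {in ~: states1 G, forall s, edge s (tau s)} ->
  exists pi', [/\ is_play pi', consistent pi', forall i, (i <= n)%N -> pi' i = pi i
    & forall m, (n <= m)%N -> pi' m \notin states1 G -> pi' m.+1 = tau (pi' m)].
Proof.
move=> [pi0 pi_e] cons tauE.
(* A prefix of [pi] with at most [n] states is continued by [pi], so agreement includes [pi n];
   afterwards [f] and [tau] decide. *)
pose F h := if (size h <= n)%N && (h == mkseq pi (size h)) then pi (size h)
            else against tau h.
have [|pi' [pi'0 pi'_e] pi'S] := @play_exists F.
  move=> h s pre; rewrite /F; case: ifP => [/andP[_ /eqP]|_]; last exact: against_edge.
  rewrite size_rcons mkseqS => /rcons_inj[_ ->]; exact: pi_e.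
have agree i : (i <= n)%N -> play_prefix pi' i = play_prefix pi i.
  elim: i => [|i IHi] lt_in;
    first by rewrite /play_prefix /mkseq /= pi'0 pi0.
  rewrite play_prefixS [RHS]play_prefixS; have := IHi (ltnW lt_in).
  rewrite /play_prefix => eq_i; rewrite eq_i pi'S /F /play_prefix eq_i size_mkseq.
  by rewrite lt_in eqxx.
have agree_i i : (i <= n)%N -> pi' i = pi i.
  by move=> /agree; rewrite !play_prefixS => /rcons_inj[].
have late m : (n <= m)%N -> pi' m.+1 = against tau (play_prefix pi' m).
  by move=> le_nm; rewrite pi'S /F /play_prefix size_mkseq ltnNge le_nm.
exists pi'; split=> // [m mS1|m le_nm mS1]; last first.
  by rewrite late // /against play_prefixS last_rcons (negPf mS1).
have [lt_mn|le_nm] := ltnP m n.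
  move: mS1; rewrite /= (agree_i m.+1) // (agree_i m (ltnW lt_mn)).
  by rewrite (agree m (ltnW lt_mn)) => /cons.
by rewrite /= late // /against play_prefixS last_rcons mS1.
Qed.

Definition reachable : {set state G} :=
  [set q | `[< exists pi n, [/\ is_play pi, consistent pi & pi n = q] >]].

Lemma reachableP q : reflect (exists pi n, [/\ is_play pi, consistent pi & pi n = q])
  (q \in reachable).
Proof. by rewrite inE; exact: asboolP. Qed.

Lemma init_reachable : init G \in reachable.
Proof.
apply/reachableP; have [|pi play piS] := @play_exists (against some_edge).
  by apply: against_edge => s _; exact: some_edgeP.
exists pi, 0%N; split=> //; last by case: play.
by move=> n nS1; rewrite /= piS /against play_prefixS last_rcons nS1.
Qed.

Lemma reachable_closed s t : s \in reachable :\: states1 G -> edge s t -> t \in reachable.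
Proof.
case/setDP => /reachableP[pi [n [play cons pin]]] sS1 est.
have [|pi' [play' cons' agree late]] := @play_extend pi n
    (fun q => if q == s then t else some_edge q) play cons.
  by move=> q _; case: eqP => [->|_] //; exact: some_edgeP.
apply/reachableP; exists pi', n.+1; split=> //.
by rewrite late // agree // pin ?eqxx.
Qed.

Local Notation inside := (inside reachable).

Lemma play_against tau q :
  {in reachable :\: states1 G, forall s, inside s (tau s)} -> q \in reachable ->
  exists pi n, [/\ is_play pi, consistent pi, pi n = q &
    forall m, (n <= m)%N ->
      fix_opponent (states1 G) inside tau (pi m) (pi m.+1)].
Proof.
move=> tauE /reachableP[pi [n [play cons pin]]].
(* [tau] follows edges only on reachable states of player 2; elsewhere any successor will do, as
   consistent plays never go there. *)
have [|pi' [play' cons' agree late]] := @play_extend pi n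
    (fun s => if s \in reachable then tau s else some_edge s) play cons.
  move=> s; rewrite inE => sS1; case: ifP => [sR|_]; last exact: some_edgeP.
  by have /and3P[] : inside s (tau s) by apply: tauE; rewrite inE sS1.
have pi'R m : pi' m \in reachable by apply/reachableP; exists pi', m.
exists pi', n; split=> //; first by rewrite agree.
move=> m le_nm; have [_ e_pi'] := play'.
rewrite /fix_opponent /inside e_pi' !pi'R /=.
by have [//|mS1] := boolP (pi' m \in states1 G); rewrite late // pi'R eqxx.
Qed.
End Plays.

(** * Cutting lassos out of plays *)

Section Segments.
Variables (G : game) (d : nat) (w : state G -> state G -> 'I_d -> int).
Variables (p : state G -> nat) (e : rel (state G)) (pi : nat -> state G) (n : nat).
Hypothesis pi_e : forall m, (n <= m)%N -> e (pi m) (pi m.+1).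

Definition segment a k : seq (state G) := mkseq (fun m => pi (a + m.+1)%N) k.

Lemma segmentS a k : segment a k.+1 = rcons (segment a k) (pi (a + k.+1)%N).
Proof. exact: mkseqS. Qed.

Lemma last_segment a k : last (pi a) (segment a k) = pi (a + k)%N.
Proof. by case: k => [|k]; rewrite ?addn0 // segmentS last_rcons. Qed.

Lemma path_segment a k : (n <= a)%N -> path e (pi a) (segment a k).
Proof.
move=> le_na; elim: k => // k IHk; rewrite segmentS rcons_path IHk last_segment.
by rewrite addnS pi_e // (leq_trans le_na) ?leq_addr.
Qed.

Lemma effect_segment a k i :
  effect w (pi a) (segment a k) i = energy w pi (a + k) i - energy w pi a i.
Proof.
elim: k => [|k IHk]; first by rewrite addn0 subrr.
rewrite segmentS -cats1 effect_cat IHk last_segment /= addr0 addnS.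
by rewrite [energy w pi (a + k).+1 i]/energy big_ord_recr /= addrAC.
Qed.

Lemma segment_lasso a b m : (n <= a < m)%N -> (m <= b)%N -> pi a = pi b ->
  (forall i, energy w pi a i <= energy w pi b i) ->
  ~~ odd (p (pi m)) -> (forall m', (a < m' <= b)%N -> (p (pi m) <= p (pi m'))%N) ->
  winning_lasso w p e (pi n).
Proof.
move=> /andP[le_na lt_am] le_mb ab le_ab even_m min_m.
have naE : (n + (a - n))%N = a by lia.
have abE : (a + (b - a))%N = b by lia.
exists (segment n (a - n)), (segment a (b - a)); rewrite last_segment naE; split.
- exact: path_segment.
- apply/and3P; split; last by rewrite last_segment abE ab.
    by rewrite -size_eq0 size_mkseq; lia.
  exact: path_segment.
- by move=> i; rewrite effect_segment abE subr_ge0.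
exists (pi m).
  apply/mapP; exists (m - a).-1; last by congr pi; lia.
  by rewrite mem_iota; lia.
by split=> // x /mapP[k]; rewrite mem_iota => ltk ->; apply: min_m; lia.
Qed.
End Segments.

(** Each term is a position where [g] is least among all positions after the previous term, so later
    values cannot be smaller. *)
Lemma nondecreasing_subsequence (g : nat -> nat) :
  exists phi : nat -> nat, {homo phi : m n / (m < n)%N} /\
    {homo g \o phi : m n / (m <= n)%N}.
Proof.
have [c cP] : {c : nat -> nat & forall N, (N <= c N)%N /\
    forall m, (N <= m)%N -> (g (c N) <= g m)%N}.
  apply: (@choice _ _ (fun N c => (N <= c)%N /\ forall m, (N <= m)%N -> (g c <= g m)%N)).
  move=> N; have ex_v : exists v, `[< exists2 n, (N <= n)%N & g n = v >].
    by exists (g N); apply/asboolP; exists N.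
  case: (ex_minnP ex_v) => v /asboolP[n le_Nn gn] min_v.
  exists n; split=> // m le_Nm; rewrite gn; apply: min_v.
  by apply/asboolP; exists m.
pose phi k := iter k (fun n => c n.+1) (c 0%N).
have phi_lt k : (phi k < phi k.+1)%N by have [] := cP (phi k).+1.
exists phi; split; first by apply: homo_ltn phi_lt; exact: ltn_trans.
apply: homo_leq => [n|n m k|k]; [exact: leqnn | exact: (@leq_trans) |].
have [N [le_N phiE]] : exists N, (N <= phi k)%N /\ phi k = c N.
  case: k => [|k]; first by exists 0%N.
  by exists (phi k).+1; split=> //; have [] := cP (phi k).+1.
have [_ /(_ (phi k.+1))] := cP N; rewrite -phiE; apply.
exact: leq_trans le_N (ltnW (phi_lt k)).
Qed.

(** Subsequences are refined one coordinate at a time; refining preserves the monotonicity already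
    obtained. *)
Lemma dickson d (f : nat -> 'I_d -> nat) : exists phi : nat -> nat,
  {homo phi : m n / (m < n)%N} /\ forall i, {homo (fun n => f (phi n) i) : m n / (m <= n)%N}.
Proof.
suff /(_ (enum 'I_d)) [phi [incr mono]] : forall r : seq 'I_d, exists phi : nat -> nat,
    {homo phi : m n / (m < n)%N} /\
    {in r, forall i, {homo (fun n => f (phi n) i) : m n / (m <= n)%N}}.
  by exists phi; split=> // i; exact: (mono i (mem_enum _ i)).
elim=> [|i r [phi [incr mono]]]; first by exists id; split=> [m n|i] //; rewrite in_nil.
have [psi [incr' mono']] := nondecreasing_subsequence (fun n => f (phi n) i).
exists (phi \o psi); split=> [m n /incr' /incr //|].
move=> i'; rewrite inE => /predU1P[->|i'r] m n le_mn; first exact: mono'.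
apply: mono => //; move: le_mn; rewrite leq_eqVlt => /predU1P[->|/incr' /ltnW] //.
Qed.

Section Lassos.
Variables (R : realType) (G : game) (f : pure_strategy G).
Local Notation inside := (inside (reachable R f)).

Definition edge_weight (s t : state G) (i : 'I_(dimension G)) : int := weight s t 0 i.

Lemma energy_edge_weight pi n i : energy edge_weight pi n i = energy_level pi n 0 i.
Proof. by rewrite /energy_level summxE. Qed.

(** Among the late visits to a state [c] of least recurring priority, Dickson's lemma finds two
    between which no energy decreases. The cycle between them ends in [c], which has its least
    priority, and that priority is even. *)
Lemma energy_parity_lasso (p : state G -> nat) tau q :
  energy_parity_winning p (Pure R f) ->
  {in reachable R f :\: states1 G, forall s, inside s (tau s)} -> q \in reachable R f ->
  winning_lasso edge_weight p (fix_opponent (states1 G) inside tau) q.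
Proof.
move=> [v0 win] tauE qR; have [pi [n [play cons <- pi_e]]] := play_against tauE qR.
have [energy_pi parity_pi] := win pi play cons.
have [c [N [vis cE ge_c]]] := min_priorityP p pi.
have [occ occP] : {occ : nat -> nat & forall m, (m <= occ m)%N /\ pi (occ m) = c}.
  by apply: (@choice _ _ (fun m k => (m <= k)%N /\ pi k = c)) => m; have [k] := vis m; exists k.
pose at_c k := iter k (fun m => occ m.+1) (occ (maxn n N)).
have at_cP k : pi (at_c k) = c.
  by case: k => [|k]; [exact: (occP (maxn n N)).2 | exact: (occP (at_c k).+1).2].
have at_c_lt k : (at_c k < at_c k.+1)%N by exact: (occP (at_c k).+1).1.
have at_c_incr : {homo at_c : i j / (i < j)%N} by apply: homo_ltn at_c_lt; exact: ltn_trans.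
have at_c_ge k : (maxn n N <= at_c k)%N.
  elim: k => [|k IHk]; first exact: (occP (maxn n N)).1.
  exact: leq_trans IHk (ltnW (at_c_lt k)).
(* These sums are nonnegative on a winning play, so the absolute value preserves them. *)
pose level k (i : 'I_(dimension G)) :=
  absz ((v0 0 i)%:Z + energy_level pi (at_c k) 0 i)%R.
have [phi [incr mono]] := dickson level.
have lt_ab : (at_c (phi 0%N) < at_c (phi 1%N))%N by apply: at_c_incr; apply: incr.
apply: (@segment_lasso _ _ _ p _ pi n pi_e (at_c (phi 0%N)) (at_c (phi 1%N)) (at_c (phi 1%N))).
- by rewrite lt_ab andbT (leq_trans _ (at_c_ge _)) // leq_maxl.
- by [].
- by rewrite !at_cP.
- move=> i; have := mono i 0%N 1%N isT; rewrite -lez_nat /level !gez0_abs //.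
  by rewrite !energy_edge_weight lerD2l.
- by rewrite at_cP cE.
- move=> m /andP[lt_m _]; rewrite at_cP cE; apply: ge_c.
  by apply: leq_trans (ltnW lt_m); apply: leq_trans (at_c_ge _); rewrite leq_maxr.
Qed.
End Lassos.

(** * Mean-payoff thresholds as energy conditions *)

Section MeanPayoff.
Variables (R : realType) (G : game) (v : 'rV[rat]_(dimension G)).

(** Multiplication by the denominator keeps weights integral while the threshold becomes 0. *)
Definition shifted_weight (s t : state G) (i : 'I_(dimension G)) : int :=
  denq (v 0 i) * weight s t 0 i - numq (v 0 i).

Lemma energy_shifted pi n i : energy shifted_weight pi n i =
  denq (v 0 i) * energy_level pi n 0 i - n%:Z * numq (v 0 i).
Proof.
rewrite /energy sumrB -mulr_sumr sumr_const card_ord /energy_level summxE.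
by rewrite -mulr_natl natz.
Qed.

Lemma average_shifted pi n i : (0 < n)%N ->
  (energy_level pi n 0 i)%:~R / n%:R =
  ratr (v 0 i) + (energy shifted_weight pi n i)%:~R / (n%:R * (denq (v 0 i))%:~R) :> R.
Proof.
move=> n0; rewrite energy_shifted; have den0 : (denq (v 0 i))%:~R != 0 :> R.
  by rewrite intr_eq0 denq_neq0.
have n0' : n%:R != 0 :> R by rewrite pnatr_eq0 -lt0n.
rewrite /ratr intrB !intrM -pmulrn; field; by rewrite den0.
Qed.

(** The average over [n] steps falls below the threshold by at most [B / n], which tends to 0. *)
Lemma mean_payoff_of_energy pi (B : nat) :
  (forall n i, - B%:Z <= energy shifted_weight pi n i) -> mean_payoff_ge R v pi.
Proof.
move=> lowB i; rewrite /mean_payoff limn_einf_lim.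
apply/lee_subgt0Pr => eps eps0.
rewrite (cvg_lim _ (@cvg_einfs_sup R _)) //.
pose N := Num.bound (B%:R / eps).
have ltN : B%:R < N%:R * eps
  by rewrite -ltr_pdivrMr //; apply: archi_boundP; rewrite divr_ge0 ?ler0n ?ltW.
apply: (@le_trans _ _ (einfs (fun n : nat =>
  ((energy_level pi n 0 i)%:~R / n%:R : R)%:E) N)); last first.
  by apply: ereal_sup_ubound; exists N.
apply: le_ereal_inf_tmp => _ [n /= le_Nn <-].
have n0 : (0 < n)%N.
  apply: leq_trans le_Nn; rewrite lt0n; apply: contraTneq ltN => ->.
  by rewrite mul0r -leNgt.
rewrite average_shifted // -EFinB lee_fin lerD2l.
have den1 : 1 <= (denq (v 0 i))%:~R :> R.
  by rewrite (ler1z R) -gtz0_ge1 denq_gt0.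
have n_gt0 : 0 < n%:R :> R by rewrite ltr0n.
rewrite ler_pdivlMr; last by rewrite mulr_gt0 // (lt_le_trans _ den1).
apply: (@le_trans _ _ (- B%:R)); last first.
  by have := lowB n i; rewrite -(ler_int R) rmorphN.
rewrite mulNr lerN2; apply: le_trans (ltW ltN) _; rewrite mulrC ler_pM2l //.
rewrite -[leLHS]mulr1; apply: ler_pM => //; first by rewrite ler_nat.
Qed.

Lemma average_of_mean_payoff pi i (eps : R) : mean_payoff_ge R v pi -> 0 < eps ->
  exists N, forall n, (N <= n)%N ->
    ratr (v 0 i) - eps <= (energy_level pi n 0 i)%:~R / n%:R.
Proof.
move=> /(_ i); rewrite /mean_payoff limn_einf_lim => mp eps0.
have : (((ratr (v 0 i) - eps)%:E : \bar R) <
    limn (einfs (fun n : nat => ((energy_level pi n 0 i)%:~R / n%:R)%:E)))%E.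
  by apply: lt_le_trans mp; rewrite lte_fin ltrBlDr ltrDl.
rewrite (cvg_lim _ (@cvg_einfs_sup R _)) // => /ereal_sup_gt [_ [N _ <-]] lt.
exists N => n leNn; rewrite -lee_fin; apply: le_trans (ltW lt) _.
by apply: ereal_inf_lbound; exists n.
Qed.
End MeanPayoff.

Section MeanPayoffLasso.
Variables (R : realType) (G : game) (v : 'rV[rat]_(dimension G)).
Variables (f : pure_strategy G) (M : moore_machine G).
Hypothesis M_f : encodes M f.
Local Notation inside := (inside (reachable R f)).

Lemma prefix_of_play (pi : nat -> state G) n : is_play pi -> is_prefix (play_prefix pi n).
Proof.
move=> [pi0 pi_e]; elim: n => [|n IHn]; first by rewrite /= pi0 eqxx.
rewrite play_prefixS mkseqS; apply: is_prefix_rcons (pi_e n).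
by rewrite -play_prefixS.
Qed.

(** Against [tau], the pair of state and memory evolves deterministically, so it repeats and the
    play becomes periodic. A negative effect of the period would cost at least 1 per round and push
    the average below the threshold. *)
Lemma mean_payoff_lasso tau q : mean_payoff_winning v (Pure R f) ->
  {in reachable R f :\: states1 G, forall s, inside s (tau s)} -> q \in reachable R f ->
  winning_lasso (shifted_weight v) (fun=> 0%N) (fix_opponent (states1 G) inside tau) q.
Proof.
move=> win tauE qR; have [pi [n [play cons <- pi_e]]] := play_against tauE qR.
have mp := win pi play cons.
pose mem m := foldl (@mem_update G M) (mem_init M) (mkseq pi m).
pose conf m := (pi m, mem m).
have memS m : mem m.+1 = mem_update (mem m) (pi m) by rewrite /mem mkseqS foldl_rcons.
have det a b : (n <= a)%N -> (n <= b)%N -> conf a = conf b -> conf a.+1 = conf b.+1.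
  move=> le_na le_nb [pi_ab mem_ab]; rewrite /conf !memS pi_ab mem_ab; congr (_, _).
  have next c : (n <= c)%N -> pi c.+1 =
      if pi c \in states1 G then Defs.mem_next (mem c) (pi c) else tau (pi c).
    move=> le_nc; case: ifPn => S1c; last first.
      by have := pi_e c le_nc; rewrite /fix_opponent (negPf S1c) => /andP[_ /eqP].
    have -> : pi c.+1 = f (play_prefix pi c) := cons c S1c.
    have := prefix_of_play c play.
    by rewrite play_prefixS => pre; exact: M_f.
  by rewrite !next // pi_ab mem_ab.
have [a [b [le_na lt_ab conf_ab]]] : exists a b, [/\ (n <= a)%N, (a < b)%N & conf a = conf b].
  pose T := (state G * memory M)%type.
  have /injectivePn[a [b neq_ab ab]] : ~~ injectiveb (fun a : 'I_#|{: T}|.+1 => conf (n + a)%N).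
    apply/negP => /injectiveP inj; have := leq_card _ inj.
    by rewrite card_ord ltnn.
  case: (ltngtP a b) => [lt|lt|/val_inj eq_ab]; last by rewrite eq_ab eqxx in neq_ab.
    by exists (n + a)%N, (n + b)%N; rewrite leq_addr ltn_add2l.
  by exists (n + b)%N, (n + a)%N; rewrite leq_addr ltn_add2l.
have conf_abm m : conf (a + m)%N = conf (b + m)%N.
  elim: m => [|m IHm]; rewrite ?addn0 // !addnS; apply: det => //; lia.
have [pi_ab _] := conf_ab.
apply: (@segment_lasso _ _ _ _ _ pi n pi_e a b b) => //; first by rewrite le_na.
move=> i; rewrite leNgt; apply/negP => lt_E.
pose E m := energy (shifted_weight v) pi m i.
have E_step m : E (b + m)%N - E (a + m)%N = E b - E a.
  elim: m => [|m IHm]; rewrite ?addn0 // -IHm !addnS.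
  rewrite /E /energy !big_ord_recr /=.
  have [-> _] := conf_abm m; have := conf_abm m.+1; rewrite !addnS => -[-> _].
  by rewrite opprD addrACA subrr addr0.
have E_k k : E (a + k * (b - a))%N <= E a - k%:Z.
  elim: k => [|k IHk]; first by rewrite mul0n addn0 subr0.
  have := E_step (k * (b - a))%N; have -> : (b + k * (b - a))%N = (a + k.+1 * (b - a))%N by lia.
  have : E b - E a <= - 1 by move: lt_E; rewrite -/(E a) -/(E b); lia.
  move: IHk; move: (E _) (E (a + k.+1 * _)%N) (E b - E a) => *; lia.
pose L := (b - a)%N; pose den : R := (denq (v 0 i))%:~R.
have den0 : 0 < den by rewrite ltr0z denq_gt0.
have L0 : 0 < L%:R :> R by rewrite ltr0n subn_gt0.
(* Losing 1 every [L] steps costs [1 / (L * den)] on average. [eps] is half of this, and [k > X]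
   rounds outweigh the part before the loop. *)
pose eps := (2 * L%:R * den)^-1.
have eps0 : 0 < eps by rewrite invr_gt0 !mulr_gt0.
have [N NP] := average_of_mean_payoff i mp eps0.
pose X : R := 2 * ((E a)%:~R + eps * den * a%:R).
pose k := (N + Num.bound `|X|).+1.
have ltX : X < k%:R.
  apply: le_lt_trans (ler_norm _) _; apply: lt_le_trans (archi_boundP (normr_ge0 X)) _.
  by rewrite ler_nat leqW ?leq_addl.
have L1 : (0 < L)%N by rewrite subn_gt0.
have n0 : (0 < a + k * L)%N by rewrite addn_gt0 muln_gt0 L1 orbT.
have le_N : (N <= a + k * L)%N by rewrite /k; nia.
have := NP _ le_N; rewrite (@average_shifted R G v pi _ i n0) lerD2l ler_pdivlMr; last first.
  by rewrite mulr_gt0 // ltr0n.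
have : (E (a + k * L)%N)%:~R <= (E a)%:~R - k%:R :> R.
  by rewrite -[k%:R]/((k%:Z)%:~R) -intrB ler_int.
rewrite -/(E _) -/den natrD natrM => E_le le_E; have := le_trans le_E E_le.
have -> : - eps * ((a%:R + k%:R * L%:R) * den) = - (eps * den * a%:R) - k%:R / 2.
  by rewrite /eps; field; rewrite !gt_eqF.
move: ltX; rewrite /X; move: (eps * den * a%:R) ((E a)%:~R) => x y; lra.
Qed.
End MeanPayoffLasso.

(** * Sizes *)

Lemma fact_le_exp m j : (j <= m)%N -> (j`! <= m ^ j)%N.
Proof.
elim: j => // j IHj lt_jm; rewrite factS expnS leq_mul //.
exact/IHj/ltnW.
Qed.

(** For size [n] there are at most [2 * n] counters and weights up to [2 ^ (3 * n)], so [coef_bound]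
    is at most [2 ^ (14 * n ^ 2)] and a counter takes at most [2 ^ (14 * n ^ 2 + 7 * n + 3)] values.
    The power [2 * n] of this, a factor [2 ^ n] for the stored state and the initial memory give the
    polynomial. *)
Definition memory_poly : {poly nat} :=
  28%N%:P * 'X^3 + 14%N%:P * 'X^2 + 7%N%:P * 'X + 1%N%:P.

Lemma memory_polyE n : memory_poly.[n] = (28 * n ^ 3 + 14 * n ^ 2 + 7 * n + 1)%N.
Proof. by rewrite /memory_poly !hornerE. Qed.

Lemma memory_bound (G : game) (d n : nat) :
  (#|state G| <= n)%N -> (d <= n)%N -> (edges G <= n)%N ->
  ((#|state G| * (counter_bound G d (2 ^ (3 * n))).+1 ^ (d + #|state G|)).+1
   <= 2 ^ memory_poly.[n])%N.
Proof.
rewrite memory_polyE /counter_bound /lasso_bound /walk_bound /coef_bound card_sum card_ord.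
set s := #|state G|; set j := (d + s)%N; set N2 := (s.+1 * s.+1)%N.
move=> le_sn le_dn le_En.
have p2 a b : (a <= b)%N -> (2 ^ a <= 2 ^ b)%N by rewrite leq_exp2l.
have exp_mono a b k : (a <= b)%N -> (a ^ k <= b ^ k)%N.
  by move=> le_ab; case: k => // k; rewrite leq_exp2r.
have sum3 a b c y : (a <= y -> b <= y -> c <= y -> a + (b + c) <= y * 2 ^ 2)%N by lia.
have ltn2 a : (a < 2 ^ a)%N by rewrite ltn_expl.
have s_le : (s <= 2 ^ n)%N by apply: leq_trans le_sn (ltnW (ltn2 n)).
have N2_le : (N2 <= 2 ^ (2 * n))%N.
  by rewrite mul2n -addnn expnD leq_mul // (leq_ltn_trans le_sn).
have j_le : (j <= 2 * n)%N by rewrite /j; lia.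
have j_le2 : (j <= 2 ^ (2 * n))%N by apply: leq_trans j_le (ltnW (ltn2 _)).
set C := (j`! * _)%N.
have C_le : (C <= 2 ^ (14 * n ^ 2))%N.
  have -> : (14 * n ^ 2 = 2 * n * (2 * n) + 5 * n * (2 * n))%N by nia.
  rewrite expnD; apply: leq_mul.
    apply: leq_trans (fact_le_exp j_le2) _.
    by rewrite -expnM p2 // leq_mul2l j_le orbT.
  apply: (@leq_trans ((2 ^ (5 * n)) ^ j)).
    apply: exp_mono; have -> : (5 * n = 3 * n + 2 * n)%N by lia.
    by rewrite expnD leq_mul.
  by rewrite -expnM p2 // leq_mul2l j_le orbT.
have le_walk : (s + (C * N2 + j * C * s) <= 2 ^ (14 * n ^ 2 + 3 * n + 2))%N.
  have h1 : (C * N2 <= 2 ^ (14 * n ^ 2 + 3 * n))%N.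
    apply: (@leq_trans (2 ^ (14 * n ^ 2) * 2 ^ (2 * n))); first exact: leq_mul.
    by rewrite -expnD p2 //; lia.
  have h2 : (j * C * s <= 2 ^ (14 * n ^ 2 + 3 * n))%N.
    apply: (@leq_trans (2 ^ (2 * n) * 2 ^ (14 * n ^ 2) * 2 ^ n)).
      by rewrite !leq_mul.
    by rewrite -!expnD p2 //; lia.
  have h3 : (s <= 2 ^ (14 * n ^ 2 + 3 * n))%N by apply: leq_trans s_le _; rewrite p2 //; lia.
  by rewrite (expnD 2); exact: sum3.
set B := (2 ^ _ * _)%N.
have B_le : (B <= 2 ^ (14 * n ^ 2 + 7 * n + 2))%N.
  have -> : (14 * n ^ 2 + 7 * n + 2 = n + (3 * n + (14 * n ^ 2 + 3 * n + 2)))%N by lia.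
  by rewrite 2!(expnD 2); apply: leq_mul; [exact: p2 | exact: leq_mul].
have B1_le : (B.+1 <= 2 ^ (14 * n ^ 2 + 7 * n + 3))%N.
  have -> : (14 * n ^ 2 + 7 * n + 3 = (14 * n ^ 2 + 7 * n + 2).+1)%N by lia.
  rewrite (expnS 2) mul2n -addnn -addn1.
  by apply: leq_add; rewrite // expn_gt0.
have pow_le : (B.+1 ^ j <= 2 ^ (28 * n ^ 3 + 14 * n ^ 2 + 6 * n))%N.
  apply: (@leq_trans ((2 ^ (14 * n ^ 2 + 7 * n + 3)) ^ j)); first exact: exp_mono.
  rewrite -expnM p2 //; apply: (@leq_trans ((14 * n ^ 2 + 7 * n + 3) * (2 * n))).
    by rewrite leq_mul2l j_le orbT.
  by apply: eq_leq; nia.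
have : (s * B.+1 ^ j <= 2 ^ (28 * n ^ 3 + 14 * n ^ 2 + 7 * n))%N.
  have -> : (28 * n ^ 3 + 14 * n ^ 2 + 7 * n = n + (28 * n ^ 3 + 14 * n ^ 2 + 6 * n))%N by lia.
  by rewrite [X in (_ <= X)%N]expnD; exact: leq_mul.
move=> le_s; rewrite [X in (_ <= 2 ^ X)%N]addn1 (expnS 2) mul2n -addnn -addn1.
by apply: leq_add; rewrite // expn_gt0.
Qed.

Lemma le_sum_size (I : finType) (P : pred I) (F : I -> nat) i :
  P i -> (F i <= \sum_(j | P j) F j)%N.
Proof. by move=> Pi; rewrite (bigD1 i) //= leq_addr. Qed.

Lemma int_size_bound z : `|z| <= (2 ^ int_size z)%N%:Z.
Proof.
rewrite -abszE lez_nat; apply: ltnW; apply: leq_trans (_ : 2 ^ nat_size `|z| <= _)%N.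
  exact: trunc_log_ltn.
by rewrite leq_exp2l.
Qed.

Section Sizes.
Variable G : game.

Lemma states_le_size : (#|state G| <= game_size G)%N.
Proof.
rewrite /game_size -sum1_card -addnA addnCA; apply: leq_trans (leq_addr _ _).
by apply: leq_sum.
Qed.

Lemma edge_size s t : edge s t ->
  (2 + \sum_(i < dimension G) int_size (weight s t ord0 i) <= game_size G)%N.
Proof.
move=> est; apply: leq_trans (leq_addl _ _).
apply: leq_trans (@le_sum_size _ (fun a : state G * state G => edge a.1 a.2) _ (s, t) est).
by rewrite leq_add2r mulnS.
Qed.

Lemma edges_le_size : (edges G <= game_size G)%N.
Proof.
rewrite /edges -sum1_card; apply: leq_trans (leq_addl _ _).
by apply: leq_sum => a _; rewrite mulnS.
Qed.

Lemma dimension_le_size : (dimension G <= game_size G)%N.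
Proof.
have [t est] := edge_total (init G); apply: leq_trans (edge_size est).
rewrite -{1}[dimension G]card_ord -sum1_card; apply: leq_trans (leq_addl _ _).
by apply: leq_sum.
Qed.

Lemma size_gt0 : (0 < game_size G)%N.
Proof. by apply: leq_trans states_le_size; apply/card_gt0P; exists (init G). Qed.

Lemma weight_bound n (s t : state G) i : (game_size G <= n)%N -> edge s t ->
  `|weight s t 0 i| <= (2 ^ n)%N%:Z.
Proof.
move=> le_n est; apply: le_trans (int_size_bound _) _.
rewrite lez_nat leq_exp2l //; apply: leq_trans le_n; apply: leq_trans (edge_size est).
apply: leq_trans (leq_addl _ _).
by rewrite (bigD1 i) //= leq_addr.
Qed.

(** Denominator, weight and numerator are each at most [2 ^ n], so the total is at most
    [2 ^ (2 * n + 1)], and [n] is positive. *)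
Lemma shifted_weight_bound (v : 'rV[rat]_(dimension G)) s t i : edge s t ->
  `|shifted_weight v s t i| <= (2 ^ (3 * threshold_game_size v))%N%:Z.
Proof.
move=> est; set n := threshold_game_size v.
have le_Gn : (game_size G <= n)%N by rewrite leq_addr.
have rat_le : (int_size (numq (v 0%R i)) + int_size (denq (v 0%R i)) <= n)%N.
  by apply: leq_trans (leq_addl _ _); rewrite (bigD1 i) //= leq_addr.
have size_le z : (int_size z <= n)%N -> `|z| <= (2 ^ n)%N%:Z.
  by move=> le_zn; apply: le_trans (int_size_bound z) _; rewrite lez_nat leq_exp2l.
have n0 : (0 < n)%N := leq_trans size_gt0 le_Gn.
apply: (@le_trans _ _ (2 ^ n * 2 ^ n + 2 ^ n)%N%:Z).
  apply: le_trans (ler_normB _ _) _; rewrite PoszD PoszM normrM.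
  apply: lerD; last by apply: size_le; lia.
  by apply: ler_pM => //; [apply: size_le; lia | exact: weight_bound].
rewrite lez_nat; apply: (@leq_trans (2 ^ (2 * n) + 2 ^ (2 * n))).
  by apply: leq_add; rewrite -?expnD leq_exp2l //; lia.
by rewrite addnn -mul2n -expnS leq_exp2l //; lia.
Qed.
End Sizes.

(** * Exponential memory suffices *)

Section UpperBounds.
Variables (R : realType) (G : game).

(** Fixing one move of the support after every history can only remove consistent plays. *)
Lemma pure_of_strategy (sigma : strategy R G) : exists f : pure_strategy G,
  forall pi, is_play pi -> consistent (Pure R f) pi -> consistent sigma pi.
Proof.
case: sigma => [f|D]; first by exists f.
have pick_t h s : is_prefix (rcons h s) -> s \in states1 G -> exists t, 0 < D (rcons h s) t.
  move=> pre sS1; apply: contrapT => /forallNP no.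
  have := distr_sum1 D pre sS1; rewrite big1 => [/esym/eqP|t _].
    by rewrite oner_eq0.
  apply/eqP; rewrite eq_le distr_ge0 // andbT leNgt; exact/negP/no.
pose c h := odflt (init G) [pick t | 0 < D h t].
have cP h s : is_prefix (rcons h s) -> s \in states1 G -> 0 < D (rcons h s) (c (rcons h s)).
  move=> pre sS1; rewrite /c; case: pickP => [//|no].
  by have [t] := pick_t h s pre sS1; rewrite no.
have c_edge h s : is_prefix (rcons h s) -> s \in states1 G -> edge s (c (rcons h s)).
  by move=> pre sS1; apply: (@distr_edge R G D h s pre sS1); rewrite gt_eqF ?cP.
exists (PureStrategy c_edge) => pi play cons n S1n.
have piS : pi n.+1 = c (play_prefix pi n) := cons n S1n.
rewrite /= piS; have := prefix_of_play n play.
by rewrite play_prefixS => /cP; apply.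
Qed.

Lemma energy_parity_upper (p : state G -> nat) (sigma : strategy R G) :
  energy_parity_winning p sigma -> exists2 f : pure_strategy G,
  memory_at_most (2 ^ memory_poly.[game_size G])%N f & energy_parity_winning p (Pure R f).
Proof.
move=> [v0 win]; have [f0 f0P] := pure_of_strategy sigma.
have win0 : energy_parity_winning p (Pure R f0).
  by exists v0 => pi play /(f0P pi play); exact: win.
have [|||||f fM fP] := @energy_parity_strategy R G (dimension G) (@edge_weight G) p
    (reachable R f0) (2 ^ (3 * game_size G))%N.
- by rewrite expn_gt0.
- move=> s t i est; apply: le_trans (weight_bound i (leqnn _) est) _.
  by rewrite lez_nat leq_exp2l //; lia.
- exact: init_reachable.
- by move=> s t; exact: reachable_closed.
- by move=> tau tauE q qR; exact: energy_parity_lasso.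
exists f.
  case: fM => M fM leM; exists M => //; apply: leq_trans leM _.
  by apply: memory_bound; rewrite ?states_le_size ?dimension_le_size ?edges_le_size.
have [B BP] := fP.
exists (const_mx B) => pi play cons; have [low_B par] := BP pi play cons.
split=> // n j; rewrite mxE -energy_edge_weight -lerBlDl sub0r.
exact: low_B.
Qed.

Lemma mean_payoff_upper (v : 'rV[rat]_(dimension G)) (f0 : pure_strategy G) :
  finite_memory f0 -> mean_payoff_winning v (Pure R f0) ->
  exists2 f : pure_strategy G,
  memory_at_most (2 ^ memory_poly.[threshold_game_size v])%N f &
  mean_payoff_winning v (Pure R f).
Proof.
move=> [M M_f0] win.
have [|||||f fM [B BP]] := @energy_parity_strategy R G (dimension G) (shifted_weight v)
    (fun=> 0%N) (reachable R f0) (2 ^ (3 * threshold_game_size v))%N.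
- by rewrite expn_gt0.
- exact: shifted_weight_bound.
- exact: init_reachable.
- by move=> s t; exact: reachable_closed.
- by move=> tau tauE q qR; exact: (mean_payoff_lasso M_f0).
have le_size : (game_size G <= threshold_game_size v)%N by rewrite leq_addr.
exists f.
  case: fM => M' fM' leM; exists M' => //; apply: leq_trans leM _.
  apply: memory_bound; apply: leq_trans le_size.
  - exact: states_le_size.
  - exact: dimension_le_size.
  - exact: edges_le_size.
move=> pi play cons; apply: (@mean_payoff_of_energy _ _ _ _ B).
by have [] := BP pi play cons.
Qed.
End UpperBounds.

Lemma poly_nat_mono (P : {poly nat}) m n : (m <= n)%N -> (P.[m] <= P.[n])%N.
Proof.
move=> le_mn; rewrite !horner_coef.
elim/big_rec2: _ => // i a b _ le_ab; apply: leq_add => //.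
apply: leq_mul => //; case: (nat_of_ord i) => // k; elim: k => // k IHk.
by rewrite !exprS; apply: leq_mul => //; rewrite -!exprS.
Qed.

(** * The copying game *)

Section CopyGame.
Variable K : nat.

(* In every round, player 2 chooses the bits at positions [0], ..., [K - 1] and
   player 1 those at positions [K + 1], ..., [2 * K]; the bit at position [K] is
   fixed, so that the state there carries no information. *)
Definition copy_state : finType := ('I_(2 * K).+1 * bool)%type.

Definition copy_edge : rel copy_state := fun s t =>
  (t.1 == ordS s.1) && ((val t.1 == K) ==> ~~ t.2).

Lemma copy_edge_total s : exists t, copy_edge s t.
Proof. by exists (ordS s.1, false); rewrite /copy_edge eqxx implybT. Qed.

Definition bit_sign (b : bool) : int := if b then 1 else -1.

Definition copy_level (s : copy_state) (l : nat) : int :=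
  if val s.1 == l then bit_sign s.2
  else if val s.1 == (K.+1 + l)%N then - bit_sign s.2 else 0.

(** Dimensions [l] and [K + l] are opposite, so credits bound level [l] on both sides and player 1
    must undo every bit. A bit is charged when its state is left. *)
Definition copy_weight (s t : copy_state) : 'rV[int]_(2 * K) :=
  \row_j (if (j < K)%N then copy_level s j else - copy_level s (j - K)).

Definition copy_game : game :=
  @Game copy_state [set s | (K < ordS s.1)%N] (ord_max, false)
    copy_edge copy_edge_total (2 * K) copy_weight.

Lemma copy_level_unit s l : copy_level s l \in [:: -1; 0; 1 : int].
Proof.
rewrite !inE /copy_level /bit_sign.
by case: ifP => _; [|case: ifP => _]; case: s.2; rewrite ?opprK ?eqxx ?orbT.
Qed.

Lemma copy_weight_unit s t j : copy_weight s t 0 j \in [:: -1; 0; 1 : int].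
Proof.
rewrite mxE; case: ifP => _; first exact: copy_level_unit.
have := copy_level_unit s (j - K); rewrite !inE.
by case/or3P => /eqP ->.
Qed.

Lemma copy_states : #|copy_state| = (4 * K + 2)%N.
Proof. by rewrite card_prod card_ord card_bool; lia. Qed.

Lemma nat_size_le n : (nat_size n <= n.+1)%N.
Proof.
rewrite ltnS; case: n => // n; apply: ltnW.
by apply: (@leq_trans (2 ^ trunc_log 2 n.+1)); [rewrite ltn_expl | exact: trunc_logP].
Qed.

Lemma copy_game_size : (game_size copy_game <= 7 * (4 * K + 2) ^ 3)%N.
Proof.
rewrite /game_size /= -copy_states; set m := #|copy_state|.
have mE : m = (4 * K + 2)%N := copy_states.
have size_m := nat_size_le m; have size_K := nat_size_le (2 * K).
have states_le : (\sum_(s : copy_state) (nat_size m).+1 <= m * m.+2)%N.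
  by rewrite sum_nat_const leq_mul2l ltnS size_m orbT.
have edges_le : (\sum_(e : copy_state * copy_state | copy_edge e.1 e.2)
    (2 * nat_size m + \sum_(j < 2 * K) int_size (copy_weight e.1 e.2 ord0 j))
    <= m * m * (3 * m))%N.
  apply: (@leq_trans (\sum_(e : copy_state * copy_state) (3 * m)%N)); last first.
    by rewrite sum_nat_const card_prod.
  rewrite big_mkcond; apply: leq_sum => e _; case: ifP => // _.
  apply: (@leq_trans (2 * m.+1 + \sum_(j < 2 * K) 2)).
    apply: leq_add; first by rewrite leq_mul2l size_m orbT.
    apply: leq_sum => j _; have := copy_weight_unit e.1 e.2 j.
    by rewrite !inE => /or3P[] /eqP ->.
  by rewrite sum_nat_const card_ord mE; lia.
apply: (@leq_trans ((2 * K).+1 + m.+1 + m * m.+2 + m * m * (3 * m))).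
  by rewrite !leq_add.
nia.
Qed.

Definition copy_free (s : copy_state) (j : 'I_(2 * K)) := false.
Definition copy_w (s t : copy_state) (j : 'I_(2 * K)) : int := copy_weight s t 0 j.

(* At position [i], player 2 has chosen the bit [l] and player 1 has not copied it
   yet: its two dimensions are then at levels 0 and 2 instead of 1. *)
Definition pending (i l : nat) : bool := (l < i <= K.+1 + l)%N.

(** The last clause makes the bit at position [K + 1 + l] the copy that brings the level back to 1
    when this state is left. *)
Definition copy_invariant (s : copy_state) (x : 'I_(2 * K) -> nat) : Prop :=
  exists u : nat -> nat,
  [/\ forall j : 'I_(2 * K), x j = if (j < K)%N then u j else (2 - u (j - K))%N,
      forall l, (l < K)%N -> if pending s.1 l then u l = 0%N \/ u l = 2 else u l = 1%N &
      forall l, (l < K)%N -> val s.1 = (K.+1 + l)%N -> u l = if s.2 then 2 else 0%N].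

Lemma copy_step s x b : copy_invariant s x ->
  exists2 u : nat -> nat,
    (forall l, (l < K)%N -> if pending (ordS s.1) l then u l = 0%N \/ u l = 2 else u l = 1%N) &
    step copy_w copy_free s x (ordS s.1, b)
      (fun j => if (j < K)%N then u j else (2 - u (j - K))%N).
Proof.
case: s => i c [u [xE u_range u_now]] /=.
pose u' l := if val i == l then (if c then 2 else 0%N) else
  if val i == (K.+1 + l)%N then 1%N else u l.
have i'E : (i.+1 %% (2 * K).+1 = if val i == 2 * K then 0 else i.+1)%N.
  have := ltn_ord i; rewrite ltnS leq_eqVlt /= => /predU1P[->|lt_i].
    by rewrite eqxx modnn.
  by rewrite ltn_eqF // modn_small.
have lt_i := ltn_ord i.
have u'_range l : (l < K)%N ->
    if pending (ordS i) l then u' l = 0%N \/ u' l = 2 else u' l = 1%N.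
  move=> lt_lK; have := u_range l lt_lK; rewrite /= i'E /u' /pending /=.
  have [->|ne_il] := eqVneq (val i) l.
    rewrite ltnn /= ltn_eqF; last by lia.
    have -> : (l < l.+1 <= K.+1 + l)%N by lia.
    by case: (c); [right | left].
  have [-> _|ne_iKl] := eqVneq (val i) (K.+1 + l)%N.
    by rewrite ifF //; apply/negbTE; case: ifP => _; lia.
  suff -> : (l < i <= K.+1 + l)%N =
    (l < (if val i == (2 * K)%N then 0 else i.+1) <= K.+1 + l)%N by [].
  by move: ne_il ne_iKl => /= ne_il ne_iKl; case: eqP => iT; lia.
have u'_level l : (l < K)%N -> (u' l)%:Z = (u l)%:Z + copy_level (i, c) l.
  move=> lt_lK; have := u_range l lt_lK; have := u_now l lt_lK.
  rewrite /u' /copy_level /pending /bit_sign /=; have [->|ne_il] := eqVneq (val i) l.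
    by rewrite ltnn /= => _ ->; case: (c).
  have [-> /(_ erefl) -> _|_ _ _] := eqVneq (val i) (K.+1 + l)%N; last by rewrite addr0.
  by case: (c).
exists u' => // j; apply/orP; right; rewrite xE /copy_w mxE.
have lt_j := ltn_ord j; case: ltnP => [lt_jK | le_Kj]; first by rewrite u'_level.
have lt_l : (j - K < K)%N by lia.
have := u'_level _ lt_l; have := u'_range _ lt_l; have := u_range _ lt_l.
move: (copy_level _ _) (u _) (u' _) => lev y y'.
case: ifP => _; case: ifP => _; lia.
Qed.

Lemma copy_game_winning (R : realType) : (0 < K)%N ->
  exists sigma : strategy R copy_game, energy_winning sigma.
Proof.
move=> K0.
have inv : @invariant (state copy_game) _ copy_w copy_free (states1 copy_game)
    (@edge copy_game) 2 copy_invariant.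
  (* The bit [true] is a placeholder: weights depend only on the state that is left. *)
  move=> s x sx; have [u u_range u_step] := copy_step true sx.
  pose x' (j : 'I_(2 * K)) := if (j < K)%N then u j else (2 - u (j - K))%N.
  have next c : ((K < ordS s.1)%N -> c = (u (ordS s.1 - K.+1)%N == 2)) ->
      copy_invariant (ordS s.1, c) x' /\ step copy_w copy_free s x (ordS s.1, c) x'.
    move=> cE; split; last exact: u_step.
    exists u; split=> // l lt_lK /= posE; rewrite cE /= posE; last by lia.
    have := u_range l lt_lK; rewrite /pending /= posE.
    have -> : (K.+1 + l - K.+1)%N = l by lia.
    by rewrite ltnS leq_addl leqnn /= => -[]->.
  split.
  - move=> j; have [v [-> v_range _]] := sx.
    have lt_j := ltn_ord j; case: ltnP => [/v_range | _]; last by lia.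
    by case: ifP => _; lia.
  - rewrite inE => S1s; set c := u (ordS s.1 - K.+1)%N == 2.
    have [|Cx' st] := next c; first by [].
    exists (ordS s.1, c), x'; split=> //.
    by rewrite /= /copy_edge eqxx /= gtn_eqF.
  - rewrite inE => nS1 [i' c] /andP[/= /eqP -> _].
    have [|Cx' st] := next c; last by exists x'.
    by move=> lt; rewrite lt in nS1.
(* The initial state is at position [2 * K] with bit [false], as if it were the copy of a bit
   [false] at [K - 1]; hence levels 0 and 2 for that bit. *)
pose x0 (j : 'I_(2 * K)) := if (j < K)%N then (if val j == K.-1 then 0 else 1)%N
  else (2 - (if (j - K == K.-1)%N then 0 else 1))%N.
have Cx0 : copy_invariant (init copy_game) x0.
  exists (fun l => if l == K.-1 then 0%N else 1%N); split=> // l lt_lK.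
    rewrite /pending /=; case: eqP => [->|ne]; first by rewrite ifT; [left | lia].
    by rewrite ifF //; lia.
  by move=> /= posE; case: eqP => // ne; lia.
have [k0 k0E] := @countersP copy_game _ copy_w copy_free 2 copy_invariant inv _ _ Cx0.
rewrite -k0E in Cx0.
exists (Pure R (@invariant_strategy copy_game _ copy_w copy_free 2 copy_invariant k0)).
exists (const_mx 2).
move=> pi play cons n j; have [x xP] :=
  @invariant_strategy_run R copy_game _ copy_w copy_free 2 copy_invariant inv k0 Cx0 pi play cons.
rewrite mxE -energy_edge_weight.
have := @step_energy _ _ copy_w copy_free pi x j (fun _ => isT) (fun n => (xP n).2) n.
have -> : energy (@edge_weight copy_game) pi n j =
  \sum_(m < n) copy_w (pi m) (pi m.+1) j by [].
have := (xP 0%N).1 j; set E := \sum_(m < n) _; lia.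
Qed.

End CopyGame.

(** * Exponential memory is necessary *)

Section LowerBound.
Variables (R : realType) (K : nat) (v0 : 'rV[nat]_(2 * K)).
Local Notation G := (copy_game K).
Variables (f : pure_strategy G) (M : moore_machine G).
Hypothesis K_gt0 : (0 < K)%N.
Hypothesis M_f : encodes M f.
Hypothesis win : @energy_winning_for R G v0 (Pure R f).

Local Notation conf := (memory M * copy_state K)%type.

(** The input bit is ignored at position [K] and where player 1 chooses, so a whole round can be fed
    as a word of [2 * K + 1] bits. *)
Definition conf_step (x : conf) (b : bool) : conf :=
  (@mem_update G M x.1 x.2,
   (ordS x.2.1, if val (ordS x.2.1) == K then false
                else if (K < ordS x.2.1)%N then (@Defs.mem_next G M x.1 x.2).2 else b)).

Local Notation run := (foldl conf_step).

Lemma run_position x bs : val (run x bs).2.1 = ((x.2.1 + size bs) %% (2 * K).+1)%N.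
Proof.
elim/last_ind: bs => [|bs b IHbs] /=; first by rewrite addn0 modn_small.
by rewrite foldl_rcons size_rcons /= IHbs -[in LHS]addn1 modnDml addn1 addnS.
Qed.

Fixpoint cost (x : conf) (bs : seq bool) (l : nat) : int :=
  if bs is b :: bs' then copy_level x.2 l + cost (conf_step x b) bs' l else 0.

Lemma cost_cat x bs bs' l : cost x (bs ++ bs') l = cost x bs l + cost (run x bs) bs' l.
Proof. by elim: bs x => [|b bs IHbs] x /=; rewrite ?add0r // IHbs addrA. Qed.

(** Bits are charged on leaving: the bit of [x] counts, the last bit read does not yet. *)
Lemma cost_bits (x : conf) b bs l : (x.2.1 + size bs < K)%N -> (l < K)%N ->
  cost x (b :: bs) l =
  if (x.2.1 <= l <= x.2.1 + size bs)%N then bit_sign (nth false [:: x.2.2, b & bs] (l - x.2.1))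
  else 0.
Proof.
case: x => m [i c]; elim: bs m i c b => [|b' bs IHbs] m i c b lt_iK lt_lK.
  rewrite /= addr0 addn0 /copy_level /=.
  have -> : (i <= l <= i)%N = (nat_of_ord i == l) by lia.
  case: eqP => [->|_]; first by rewrite subnn.
  by rewrite ifF //; move: lt_iK; rewrite /=; lia.
rewrite /= in lt_iK.
have pos : (i.+1 %% (2 * K).+1 = i.+1)%N by rewrite modn_small //; lia.
rewrite -[LHS]/(copy_level (i, c) l + cost (conf_step (m, (i, c)) b) (b' :: bs) l).
rewrite IHbs //=; last by rewrite pos; lia.
rewrite pos ltn_eqF; last by lia.
have -> : (K < i.+1)%N = false by lia.
rewrite /copy_level /=; have [->|ne_il] := eqVneq (nat_of_ord i) l.
  by rewrite ltnn /= leqnn leq_addr subnn addr0.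
rewrite ifF; last by lia.
rewrite add0r.
have -> : (i < l <= i.+1 + size bs)%N = (i <= l <= i + (size bs).+1)%N by lia.
case: ifP => // lt_il; have -> : (l - i = (l - i.+1).+1)%N by lia.
by [].
Qed.

(** The appended bit leads to position [K], so exactly the positions [2 * K] and [0] to [K - 1] are
    left and charged. *)
Lemma cost_word (x : conf) (b : K.-tuple bool) l : val x.2.1 = (2 * K)%N -> (l < K)%N ->
  cost x (rcons b false) l = copy_level x.2 l + bit_sign (nth false b l).
Proof.
case: x => m [i c] /= posx lt_lK.
have -> : nth false b l = nth false (rcons b false) l by rewrite nth_rcons size_tuple lt_lK.
have : size (rcons b false) = K.+1 by rewrite size_rcons size_tuple.
have pos0 : (i.+1 %% (2 * K).+1 = 0)%N by rewrite posx modnn.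
case: (rcons b false) => // b0 [|b1 bs] [sz]; first by have := K_gt0; lia.
rewrite -[LHS]/(copy_level (i, c) l + cost (conf_step (m, (i, c)) b0) (b1 :: bs) l).
rewrite cost_bits //= pos0; last by lia.
have -> : (0 == K)%N = false by have := K_gt0; lia.
by rewrite subn0 add0n leq0n /= ifT //; lia.
Qed.

Hypothesis small : (#|memory M| < 2 ^ K)%N.

(** There are more words than memory states. Both runs end at position [K], whose bit is fixed, so
    equal memory means equal configurations. *)
Lemma collision (x : conf) : val x.2.1 = (2 * K)%N ->
  exists l : 'I_K, exists w w' : K.-tuple bool,
  [/\ tnth w l = false, tnth w' l = true & run x (rcons w false) = run x (rcons w' false)].
Proof.
move=> posx.
have /injectivePn[w [w' neq_w eq_mem]] :
    ~~ injectiveb (fun w : K.-tuple bool => (run x (rcons w false)).1).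
  apply/negP => /injectiveP /leq_card; rewrite card_tuple card_bool.
  by rewrite leqNgt small.
have eq_run : run x (rcons w false) = run x (rcons w' false).
  have pos (u : K.-tuple bool) : (run x (rcons u false)).2 = (inord K, false).
    have := run_position x (rcons u false); rewrite posx size_rcons size_tuple.
    have -> : (2 * K + K.+1 = K + (2 * K).+1)%N by lia.
    rewrite modnDr modn_small; last by lia.
    rewrite foldl_rcons /= => posK; rewrite posK eqxx; congr (_, _).
    by apply: val_inj; rewrite /= posK inordK //; lia.
  move: eq_mem (pos w) (pos w').
  by case: (run x _) (run x _) => [m s] [m' s'] /= -> -> ->.
have [l neq_l] : exists l, tnth w l != tnth w' l.
  apply/existsP; rewrite -negb_forall; apply: contra neq_w => /forallP eq_w.
  by apply/eqP/eq_from_tnth => l; apply/eqP.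
exists l; case wl: (tnth w l) neq_l; case wl': (tnth w' l) => // _.
  by exists w', w.
by exists w, w'.
Qed.

Definition play_conf (bits : nat -> bool) : nat -> conf :=
  fix c n := if n is n'.+1 then conf_step (c n') (bits n') else (mem_init M, init G).

Lemma play_conf_memory bits n :
  (play_conf bits n).1 = foldl (@mem_update G M) (mem_init M)
    (mkseq (fun n => (play_conf bits n).2) n).
Proof. by elim: n => [|n IHn] //; rewrite mkseqS foldl_rcons -IHn. Qed.

Lemma play_conf_play bits : is_play (G := G) (fun n => (play_conf bits n).2).
Proof.
split=> // n; rewrite /= /copy_edge /= eqxx /=; apply/implyP => /eqP ->.
by rewrite eqxx.
Qed.

Lemma play_conf_consistent bits : consistent (Pure R f) (fun n => (play_conf bits n).2).
Proof.
move=> n S1n; have := prefix_of_play n (play_conf_play bits).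
rewrite play_prefixS => pre; rewrite /in_support (M_f pre S1n) -play_conf_memory.
have := choice_edge f pre S1n; rewrite (M_f pre S1n) -play_conf_memory.
move: S1n; rewrite inE /= /copy_edge.
case: (play_conf bits n) => m s /= lt_K /andP[/eqP pos _].
rewrite gtn_eqF // lt_K; move: pos.
by case: (Defs.mem_next _ _) => i c /= ->.
Qed.

Definition level bits n l : int := \sum_(m < n) copy_level (play_conf bits m).2 l.

(** The credits of dimensions [l] and [K + l] bound level [l] from below and from above, in all
    plays at once. *)
Lemma level_bound (l : 'I_K) : exists V : nat, forall bits bits' n n',
  level bits n l - level bits' n' l <= V%:Z.
Proof.
have lt_l := ltn_ord l.
have lt1 : (l < 2 * K)%N by lia.
have lt2 : (K + l < 2 * K)%N by lia.
pose j1 := Ordinal lt1; pose j2 := Ordinal lt2.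
exists (v0 0%R j1 + v0 0%R j2)%N => bits bits' n n'.
have lower : 0 <= (v0 0 j1)%:Z + level bits' n' l.
  have := win (play_conf_play bits') (@play_conf_consistent bits') n' j1.
  rewrite -energy_edge_weight /energy /level.
  by under eq_bigr do rewrite /edge_weight mxE lt_l.
have upper : 0 <= (v0 0 j2)%:Z - level bits n l.
  have := win (play_conf_play bits) (@play_conf_consistent bits) n j2.
  rewrite -energy_edge_weight /energy /level.
  under eq_bigr do rewrite /edge_weight mxE /= ltnNge leq_addr /= addKn.
  by rewrite sumrN.
rewrite PoszD; lia.
Qed.

Lemma level_run bits n k l :
  level bits (n + k) l = level bits n l
    + cost (play_conf bits n) (mkseq (fun i => bits (n + i)%N) k) l /\
  play_conf bits (n + k) = run (play_conf bits n) (mkseq (fun i => bits (n + i)%N) k).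
Proof.
elim: k => [|k [IHl IHr]]; first by rewrite addn0 /= addr0.
rewrite addnS mkseqS -cats1 cost_cat foldl_cat /= -IHr; split=> //.
by rewrite addr0 addrA -IHl /level big_ord_recr.
Qed.

(* The configurations [X r] at the beginning of the rounds do not depend on which
   of the two colliding words is played in each round. Hence player 2 can play the
   second word in exactly the rounds where the words differ at [l], which raises
   dimension [l] by 2 in all these rounds. *)
Lemma small_memory_loses : False.
Proof.
have [pick pickP] : {pick : conf -> 'I_K * (K.-tuple bool * K.-tuple bool) &
  forall x : conf, val x.2.1 = (2 * K)%N ->
    [/\ tnth (pick x).2.1 (pick x).1 = false, tnth (pick x).2.2 (pick x).1 = true
      & run x (rcons (pick x).2.1 false) = run x (rcons (pick x).2.2 false)]}.
  apply: (@choice _ _ (fun x p => val x.2.1 = (2 * K)%N ->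
    [/\ tnth p.2.1 p.1 = false, tnth p.2.2 p.1 = true
      & run x (rcons p.2.1 false) = run x (rcons p.2.2 false)])) => x.
  have [posx|neq] := eqVneq (val x.2.1) (2 * K)%N; last first.
    exists (Ordinal K_gt0, ([tuple of nseq K false], [tuple of nseq K false])).
    by move/eqP; rewrite (negPf neq).
  by have [l [w [w' Hw]]] := collision posx; exists (l, (w, w')).
pose word (x : conf) (b : bool) := (if b then (pick x).2.2 else (pick x).2.1) ++ nseq K.+1 false.
have size_word x b : size (word x b) = (2 * K).+1.
  by rewrite size_cat size_nseq; case: b; rewrite size_tuple; lia.
pose X r : conf := iter r (fun x => run x (word x false)) (mem_init M, init G).
have posX r : val (X r).2.1 = (2 * K)%N.
  elim: r => // r IHr; rewrite [X r.+1]/= -/(X r) run_position IHr size_word.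
  by rewrite modnDr modn_small.
have wordE x b : word x b = rcons (if b then (pick x).2.2 else (pick x).2.1) false ++ nseq K false.
  by rewrite cat_rcons.
have run_word x b : val x.2.1 = (2 * K)%N -> run x (word x b) = run x (word x false).
  move=> posx; rewrite !wordE !foldl_cat; congr (run _ _).
  by have [_ _ eq_run] := pickP x posx; case: b.
(* Exchanging the words turns -1 into 1 at [l]; afterwards the configurations agree, so the rest of
   the round costs the same. *)
have cost_pick x (l : 'I_K) : val x.2.1 = (2 * K)%N ->
    cost x (word x (l == (pick x).1)) l = cost x (word x false) l + 2 *+ (l == (pick x).1).
  move=> posx; have [wl w'l eq_run] := pickP x posx.
  rewrite !wordE !cost_cat; case: eqP => [->|_]; last by rewrite addr0.
  rewrite !cost_word // -!(tnth_nth false) wl w'l eq_run /=; ring.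
pose bits (a : nat -> bool) n :=
  (let r := n %/ (2 * K).+1 in nth false (word (X r) (a r)) (n %% (2 * K).+1))%N.
have bitsE a r : mkseq (fun i => bits a (r * (2 * K).+1 + i)%N) (2 * K).+1 = word (X r) (a r).
  apply: (@eq_from_nth _ false); rewrite size_mkseq ?size_word // => i lt_i.
  by rewrite nth_mkseq // /bits divnMDl // divn_small // addn0 modnMDl modn_small.
have rounds a r : play_conf (bits a) (r * (2 * K).+1) = X r.
  elim: r => [|r IHr] //; rewrite mulSn addnC.
  by have [_ ->] := level_run (bits a) (r * (2 * K).+1) (2 * K).+1 0; rewrite bitsE IHr run_word.
have levels a r l : level (bits a) (r.+1 * (2 * K).+1) l =
    level (bits a) (r * (2 * K).+1) l + cost (X r) (word (X r) (a r)) l.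
  rewrite mulSn addnC; have [-> _] := level_run (bits a) (r * (2 * K).+1) (2 * K).+1 l.
  by rewrite bitsE rounds.
pose a (l : 'I_K) r := l == (pick (X r)).1.
have gain (l : 'I_K) r : level (bits (a l)) (r * (2 * K).+1) l =
    level (bits (fun=> false)) (r * (2 * K).+1) l + \sum_(i < r) 2 *+ a l i.
  elim: r => [|r IHr]; first by rewrite mul0n /level !big_ord0 addr0.
  rewrite !levels big_ord_recr /= IHr /a cost_pick // addrACA [in RHS]addrA; ring.
have /fin_all_exists[V VP] := level_bound.
(* Each round contributes 2 to the gain of exactly one [l], so after [r] rounds the gains sum to
   [2 * r], more than all bounds [V l] together. *)
pose r := (\sum_l V l).+1.
have total : \sum_(l < K) \sum_(i < r) (2 *+ a l i : int) = (r * 2)%N%:Z.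
  rewrite exchange_big /= -[r in RHS]card_ord -sum_nat_const -natz natr_sum.
  apply: eq_bigr => i _; rewrite (bigD1 (pick (X i)).1) //= /a eqxx big1 ?addr0 //.
  by move=> l /negPf ->.
have : (r * 2)%N%:Z <= (\sum_l V l)%N%:Z.
  rewrite -total -natz natr_sum; apply: ler_sum => l _; rewrite (natz (V l)).
  have := VP l (bits (a l)) (bits (fun=> false)) (r * (2 * K).+1)%N (r * (2 * K).+1)%N.
  by rewrite gain [X in X <= _]addrAC subrr add0r.
by rewrite lez_nat /r; lia.
Qed.
End LowerBound.

Lemma copy_game_memory (R : realType) K (v0 : 'rV[nat]_(2 * K))
    (f : pure_strategy (copy_game K)) (M : moore_machine (copy_game K)) :
  (0 < K)%N -> encodes M f -> @energy_winning_for R (copy_game K) v0 (Pure R f) ->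
  (2 ^ K <= #|memory M|)%N.
Proof.
move=> K0 M_f win; rewrite leqNgt; apply/negP.
exact: small_memory_loses K0 M_f win.
Qed.

Theorem theorem1 (R : realType) :
  (forall (G : game) (p : state G -> nat),
     (exists sigma : strategy R G, energy_parity_winning p sigma) ->
     exists f : pure_strategy G,
       finite_memory f /\ energy_parity_winning p (Pure R f))
  /\
  (exists P : {poly nat},
     (forall (G : game) (p : state G -> nat),
        (exists f : pure_strategy G,
           finite_memory f /\ energy_parity_winning p (Pure R f)) ->
        exists f : pure_strategy G,
          memory_at_most (2 ^ P.[parity_game_size p])%N f /\
          energy_parity_winning p (Pure R f))
     /\
     (forall (G : game) (v : 'rV[rat]_(dimension G)),
        (exists f : pure_strategy G,
           finite_memory f /\ mean_payoff_winning v (Pure R f)) ->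
        exists f : pure_strategy G,
          memory_at_most (2 ^ P.[threshold_game_size v])%N f /\
          mean_payoff_winning v (Pure R f)))
  /\
  (exists G : nat -> game,
     [/\ forall K : nat, (1 <= K)%N ->
           dimension (G K) = (2 * K)%N /\
           (forall s t : state (G K), edge s t ->
              forall j, weight s t 0 j \in [:: -1; 0; 1 : int]),
         exists Q : {poly nat},
           forall K : nat, (1 <= K)%N -> (game_size (G K) <= Q.[K])%N,
         forall K : nat, (1 <= K)%N ->
           exists sigma : strategy R (G K), energy_winning sigma
       & exists2 a : R, 0 < a &
           forall K : nat, (1 <= K)%N ->
           forall (v0 : 'rV[nat]_(dimension (G K))) (f : pure_strategy (G K))
                  (M : moore_machine (G K)),
             encodes M f -> energy_winning_for v0 (Pure R f) ->
             2 `^ (a * K%:R) <= (#|memory M|)%:R ]).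
Proof.
split; first by move=> G p [sigma /energy_parity_upper [f [M M_f _] win]];
  exists f; split=> //; exists M.
split.
  exists memory_poly; split=> [G p [f [_ win]] | G v [f [fin win]]].
    have [f' [M M_f' leM] win'] := energy_parity_upper win.
    exists f'; split=> //; exists M => //; apply: leq_trans leM _.
    by rewrite leq_exp2l // poly_nat_mono // leq_addr.
  by have [f' mem_f' win'] := mean_payoff_upper fin win; exists f'.
exists copy_game; split.
- by move=> K _; split=> // s t _ j; exact: copy_weight_unit.
- exists (7%N%:P * (4%N%:P * 'X + 2%N%:P) ^+ 3) => K _.
  have -> : (7%N%:P * (4%N%:P * 'X + 2%N%:P) ^+ 3).[K] = (7 * (4 * K + 2) ^ 3)%N.
    by rewrite !hornerE.
  exact: copy_game_size.
- by move=> K; exact: copy_game_winning.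
exists 1 => // K K0 v0 f M M_f win.
by rewrite mul1r powR_mulrn // -natrX ler_nat; exact: copy_game_memory K0 M_f win.
Qed.
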